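(* Let $\mathcal{X}\subset\mathbb{R}^d$ be a finite set of data points, let $k\ge 1$ be an integer, let $\alpha>2$, and let $(C_1,\dots,C_k)$ be any partition of $\mathcal{X}$ into $k$ nonempty clusters with cost $\texttt{OPT}=\sum_{j=1}^k\sum_{x\in C_j}\lVert x-\mu_{C_j}\rVert^2$, and with $\sigma_{\mathrm{min}}>0$. Let $Z_k$ be the set of $k$ centers returned by $D^\alpha$ seeding on $\mathcal{X}$. Then $$\mathbb{E}\big[\mathrm{cost}^{(2)}(\mathcal{X},Z_k)\big]\le O\!\left(f(\alpha)\cdot (g_\alpha)^{2/\alpha}\cdot\left(\frac{\sigma_{\mathrm{max}}}{\sigma_{\mathrm{min}}}\right)^{2-4/\alpha}\cdot\big(\min\{\ell,\log k\}\big)^{2/\alpha}\right)\cdot \texttt{OPT},$$ where $f(\alpha)=\frac{\alpha^2}{(\alpha/2-1)^{2/\alpha+1}}$ and the $O(\cdot)$ hides an absolute constant. In particular $f(\alpha)=O(\alpha^2)$ as $\alpha\to\infty$.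
   Context: For $\beta\ge 1$, a finite set $C\subset\mathbb{R}^d$ and a finite nonempty set of centers $T$, $\mathrm{cost}^{(\beta)}(C,T)=\sum_{x\in C}\min_{c\in T}\lVert x-c\rVert^\beta$ (Euclidean norm); for a single point $y$, $\mathrm{cost}^{(\beta)}(C,y)=\mathrm{cost}^{(\beta)}(C,\{y\})$. $D^\alpha$ seeding: the first center $z_1\in\mathcal{X}$ is chosen uniformly at random; given the current centers $Z_t$ ($t<k$), the next center $z_{t+1}\in\mathcal{X}$ is chosen with probability $\frac{\min_{c\in Z_t}\lVert z-c\rVert^\alpha}{\sum_{y\in\mathcal{X}}\min_{c\in Z_t}\lVert y-c\rVert^\alpha}$; this is repeated until $k$ centers are chosen. For a cluster $C$, $\mu_C=\frac1{|C|}\sum_{x\in C}x$ and $\sigma_C=\sqrt{\frac{1}{|C|}\sum_{x\in C}\lVert x-\mu_C\rVert^2}$; $\sigma_{\mathrm{max}}=\max_j\sigma_{C_j}$, $\sigma_{\mathrm{min}}=\min_j\sigma_{C_j}$. The concentration parameter is $g_\alpha=\max_{j}\frac{(1/|C_j|^2)\sum_{z\in C_j}\mathrm{cost}^{(\alpha)}(C_j,z)}{(\mathrm{cost}^{(2)}(C_j,\mu_{C_j})/|C_j|)^{\alpha/2}}$. For each integer $i\ge 0$ let $k_i$ be the number of clusters $C_j$ with $|C_j|\in[2^i,2^{i+1})$, and $\ell=|\{i\ge 0: k_i>0\}|$.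
   Formalization: For k = 1 the factor log k = 0 would make the bound 0 although the expected cost is positive (e.g. two points on a line), so log k is read as ln(max{k,2}); for all k ≥ 2 the claim is unchanged. *)

(* Defs.v *)
From HB Require Import structures.
From mathcomp Require Import all_boot all_order all_algebra finmap.
From mathcomp Require Import all_classical all_reals all_analysis.

Set Implicit Arguments.
Unset Strict Implicit.
Unset Printing Implicit Defensive.

Import Order.TTheory GRing.Theory Num.Theory.
Import numFieldNormedType.Exports.

Local Open Scope fset_scope.
Local Open Scope ring_scope.

(* Minimum and maximum of a nonempty sequence of reals: the head is itself an
   element, so starting the fold from it changes nothing.  Both are 0 on the
   empty sequence, a case that is never used. *)
Definition seqmin (R : realType) (s : seq R) : R :=
  \big[Num.min/head 0 s]_(x <- s) x.

Definition seqmax (R : realType) (s : seq R) : R :=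
  \big[Num.max/head 0 s]_(x <- s) x.

(* The norm that the library puts on 'rV[R]_d is the sup norm, hence an
   explicit Euclidean norm. *)
Definition enorm (R : realType) (d : nat) (x : 'rV[R]_d) : R :=
  Num.sqrt (\sum_(i < d) x ord0 i ^+ 2).

(* Finite nonempty sets of centers are given by a sequence that enumerates them
   in any order, possibly with repetitions: the minimum sees only the
   underlying set. *)
Definition powdist (R : realType) (d : nat) (b : R)
    (x : 'rV[R]_d) (T : seq 'rV[R]_d) : R :=
  seqmin [seq enorm (x - c) `^ b | c <- T].

Definition cost (R : realType) (d : nat) (b : R)
    (C : {fset 'rV[R]_d}) (T : seq 'rV[R]_d) : R :=
  \sum_(x <- C) powdist b x T.

(* Probability that D^alpha seeding picks the centers in s, where s lists them
   in reverse order: the head of s is the last center picked.  The denominator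
   cost a X Z is nonzero as long as some point of X is not yet a center. *)
Fixpoint seeding_pmf (R : realType) (d : nat) (a : R)
    (X : {fset 'rV[R]_d}) (s : seq 'rV[R]_d) : R :=
  match s with
  | [::] => 1
  | [:: _] => (#|` X|%:R)^-1
  | z :: Z => seeding_pmf a X Z * (powdist a z Z / cost a X Z)
  end.

(* Expectation of F Z_k, with Z_k the centers returned by the seeding. *)
Definition seeding_expectation (R : realType) (d k : nat) (a : R)
    (X : {fset 'rV[R]_d}) (F : seq 'rV[R]_d -> R) : R :=
  \sum_(s : k.-tuple X)
     seeding_pmf a X [seq val z | z <- s] * F [seq val z | z <- s].

Definition mean (R : realType) (d : nat) (C : {fset 'rV[R]_d}) : 'rV[R]_d :=
  (#|` C|%:R)^-1 *: \sum_(x <- C) x.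

Definition sigma (R : realType) (d : nat) (C : {fset 'rV[R]_d}) : R :=
  Num.sqrt ((#|` C|%:R)^-1 * \sum_(x <- C) enorm (x - mean C) ^+ 2).

Definition is_clustering (R : realType) (d k : nat) (X : {fset 'rV[R]_d})
    (C : 'I_k -> {fset 'rV[R]_d}) : Prop :=
  [/\ forall j, C j != fset0,
      forall i j, i != j -> [disjoint C i & C j]
    & X = \bigcup_(j in 'I_k) C j].

Definition sigma_max (R : realType) (d k : nat)
    (C : 'I_k -> {fset 'rV[R]_d}) : R :=
  seqmax [seq sigma (C j) | j <- enum 'I_k].

Definition sigma_min (R : realType) (d k : nat)
    (C : 'I_k -> {fset 'rV[R]_d}) : R :=
  seqmin [seq sigma (C j) | j <- enum 'I_k].

Definition clustering_cost (R : realType) (d k : nat)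
    (C : 'I_k -> {fset 'rV[R]_d}) : R :=
  \sum_(j < k) \sum_(x <- C j) enorm (x - mean (C j)) ^+ 2.

Definition concentration (R : realType) (d k : nat) (a : R)
    (C : 'I_k -> {fset 'rV[R]_d}) : R :=
  seqmax [seq (#|` C j|%:R ^+ 2)^-1 * (\sum_(z <- C j) cost a (C j) [:: z])
              / (cost 2 (C j) [:: mean (C j)] / #|` C j|%:R) `^ (a / 2)
         | j <- enum 'I_k].

Definition scale_count (R : realType) (d k : nat)
    (C : 'I_k -> {fset 'rV[R]_d}) (i : nat) : nat :=
  #|[set j : 'I_k | (2 ^ i <= #|` C j| < 2 ^ i.+1)%N]|.

Definition num_scales (R : realType) (d k : nat)
    (C : 'I_k -> {fset 'rV[R]_d}) : nat :=
  #|` fset_set [set i : nat | (0 < scale_count C i)%N]%classic|.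

(* The log k of the bound: ln k for k >= 2.  For k = 1 the value ln 1 = 0 would
   make the bound 0, whereas the expected cost is then twice the cost of the
   single cluster; as usual inside O(.), log 1 is replaced by a positive
   constant. *)
Definition log_clusters (R : realType) (k : nat) : R := ln (maxn k 2)%:R.

Definition alpha_factor (R : realType) (a : R) : R :=
  a ^+ 2 / (a / 2 - 1) `^ (2 / a + 1).

(* Main.v *)
Require Import Defs.
From HB Require Import structures.
From mathcomp Require Import all_boot all_order all_algebra finmap.
From mathcomp Require Import all_classical all_reals all_analysis.
From mathcomp Require Import lra ring zify.

Set Implicit Arguments.
Unset Strict Implicit.
Unset Printing Implicit Defensive.

Import Order.TTheory GRing.Theory Num.Theory.
Import numFieldNormedType.Exports.

Local Open Scope ring_scope.

(* Put p = 2 / a and let A_j be the mean alpha-cost of the cluster C_j with respect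
   to a uniform center in C_j.  A center picked in a cluster not hit before leaves
   it with expected alpha-cost at most 2 * 2^a * A_j, whatever the other centers
   are, so the total H of the costs at the first hits satisfies
   E[H] <= 2 * 2^a * sum_j A_j.

   Fix a set S of clusters, let u be the number of those not hit yet, B their
   alpha-cost and y the sum of the q-th powers of their costs (0 < q <= 1), and
   call a step wasted if it picks a center in a cluster already hit.  Only wasted
   steps and first hits in S matter: their odds are at most H : B, a wasted step
   is charged y / u, and H * (y / u) <= (H / u)^q * (H + B).  Since u - (number of
   wasted steps) drops by one at each of these steps, the charges sum to at most
   H^q * sum_(s <= |S|) s^(-q).  At the end there are at least as many wasted steps
   as unhit clusters, so E[y] <= E[H^q] * sum_(s <= |S|) s^(-q).

   With S all clusters and q = 1 the sum is 1 + log k.  With q = p and S the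
   clusters of one scale the sum is at most |S|^(1 - p) / (1 - p), without a
   logarithm, and Hoelder's inequality over the scales gives l^p.  Hoelder's
   inequality also turns the alpha-costs into squared costs, and the spread of the
   sigma's appears on comparing |X|^(1 - p) * (sum_j A_j)^p with OPT. *)

(** * Power means and power sums *)

(** Young's inequality for the conjugate exponents 1 / (1 - p) and 1 / p. The case p = 1 is separate
    because the first exponent degenerates. *)
Lemma weighted_AMGM (R : realType) (p x y : R) :
  0 < p <= 1 -> 0 <= x -> 0 <= y ->
  x `^ (1 - p) * y `^ p <= (1 - p) * x + p * y.
Proof.
move=> /andP[p0]; rewrite le_eqVlt => /orP[/eqP-> _ y0|p1 x0 y0].
  by rewrite subrr powRr0 powRr1 // !mul1r mul0r add0r.
have q0 : 0 < 1 - p by rewrite subr_gt0.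
have := @conjugate_powR R (x `^ (1 - p)) (y `^ p) (1 - p)^-1 p^-1
  (powR_ge0 _ _) (powR_ge0 _ _).
rewrite !invr_gt0 !invrK subrK -!powRrM !mulfV ?gt_eqF // !powRr1 //.
by rewrite (mulrC x) (mulrC y); apply.
Qed.

(** The function m^(1 - p) * b^p is concave and homogeneous of degree one, hence superadditive.
    Concretely, weighted AM-GM is applied to the shares of each pair in the two totals, and the
    shares add up to one. *)
Lemma power_mean2 (R : realType) (p m b M B : R) :
  0 < p <= 1 -> 0 <= m -> 0 <= b -> 0 <= M -> 0 <= B ->
  m `^ (1 - p) * b `^ p + M `^ (1 - p) * B `^ p
  <= (m + M) `^ (1 - p) * (b + B) `^ p.
Proof.
move=> p01 m0 b0 M0 B0; have /andP[p0] := p01.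
rewrite le_eqVlt => /orP[/eqP->|p1].
  by rewrite subrr !powRr0 !mul1r !powRr1 ?addr_ge0.
have q0 : 1 - p != 0 by rewrite subr_eq0 gt_eqF.
have [/eqP|S0] := eqVneq (m + M) 0.
  by rewrite paddr_eq0 // => /andP[/eqP-> /eqP->]; rewrite addr0 powR0 // !mul0r addr0.
have [/eqP|T0] := eqVneq (b + B) 0.
  rewrite paddr_eq0 // => /andP[/eqP-> /eqP->].
  by rewrite addr0 powR0 ?gt_eqF // !mulr0 addr0.
have {}S0 : 0 < m + M by rewrite lt0r S0 addr_ge0.
have {}T0 : 0 < b + B by rewrite lt0r T0 addr_ge0.
set c := (m + M) `^ (1 - p) * (b + B) `^ p.
have c0 : 0 <= c by rewrite mulr_ge0 ?powR_ge0.
have step s t : 0 <= s -> 0 <= t -> s `^ (1 - p) * t `^ p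
    <= c * ((1 - p) * (s / (m + M)) + p * (t / (b + B))).
  move=> s0 t0.
  have -> : s `^ (1 - p) * t `^ p
      = c * ((s / (m + M)) `^ (1 - p) * (t / (b + B)) `^ p).
    by rewrite mulrACA -!powRM ?divr_ge0 ?(ltW S0) ?(ltW T0) //
      ![(_ + _) * (_ / _)]mulrC !divfK ?gt_eqF.
  by apply: ler_wpM2l => //; apply: weighted_AMGM; rewrite ?divr_ge0 // ltW.
apply: le_trans (lerD (step _ _ m0 b0) (step _ _ M0 B0)) _.
rewrite le_eqVlt; apply/orP; left; apply/eqP.
by field; rewrite !gt_eqF.
Qed.

(** Hoelder's inequality with exponents 1 / (1 - p) and 1 / p, in a form that includes p = 1. *)
Lemma power_mean (R : realType) (I : Type) (r : seq I) (P : pred I)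
    (p : R) (m b : I -> R) :
  0 < p <= 1 -> (forall i, 0 <= m i) -> (forall i, 0 <= b i) ->
  \sum_(i <- r | P i) m i `^ (1 - p) * b i `^ p
  <= (\sum_(i <- r | P i) m i) `^ (1 - p) * (\sum_(i <- r | P i) b i) `^ p.
Proof.
move=> p01 m0 b0; elim: r => [|i r IH].
  by rewrite !big_nil mulr_ge0 ?powR_ge0.
rewrite !big_cons; case: (P i) => //.
by apply: le_trans (power_mean2 p01 _ _ _ _); rewrite ?sumr_ge0 ?lerD2l.
Qed.

Lemma power_mean_card (R : realType) (I : finType) (P : pred I)
    (p : R) (b : I -> R) :
  0 < p <= 1 -> (forall i, 0 <= b i) ->
  \sum_(i | P i) b i `^ p
  <= #|P|%:R `^ (1 - p) * (\sum_(i | P i) b i) `^ p.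
Proof.
move=> p01 b0.
have := @power_mean R I (index_enum I) P p (fun=> 1) b p01 (fun=> ler01) b0.
rewrite sumr_const; under eq_bigr do rewrite powR1 mul1r.
by [].
Qed.

(** The double sum of (b i - b j) * (c i - c j) is nonnegative and equals twice the difference of
    the two sides. *)
Lemma chebyshev_sum (R : realType) (I : finType) (P : pred I) (b c : I -> R) :
  (forall i j, 0 <= (b i - b j) * (c i - c j)) ->
  (\sum_(i | P i) b i) * (\sum_(i | P i) c i)
  <= #|P|%:R * \sum_(i | P i) b i * c i.
Proof.
move=> bc; set B := \sum_(i | P i) b i; set C := \sum_(i | P i) c i.
set D := \sum_(i | P i) b i * c i.
have E i : \sum_(j | P j) (b i - b j) * (c i - c j)
    = #|P|%:R * (b i * c i) - b i * C - c i * B + D.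
  rewrite /B /C /D !mulr_sumr -!sumrN mulr_natl -sumr_const -!big_split /=.
  by apply: eq_bigr => j _; ring.
have : 0 <= \sum_(i | P i) \sum_(j | P j) (b i - b j) * (c i - c j).
  by apply: sumr_ge0 => i _; apply: sumr_ge0.
under eq_bigr do rewrite E.
rewrite !big_split /= !sumrN -!mulr_suml -mulr_sumr sumr_const -/B -/C -/D.
rewrite -[_ *+ _]mulr_natl; lra.
Qed.

Definition power_sum (R : realType) (q : R) (n : nat) : R :=
  \sum_(s < n) s.+1%:R `^ (- q).

Lemma power_sum_ge0 (R : realType) (q : R) n : 0 <= power_sum q n.
Proof. by apply: sumr_ge0 => s _; apply: powR_ge0. Qed.

Lemma power_sumS (R : realType) (q : R) n :
  power_sum q n.+1 = power_sum q n + n.+1%:R `^ (- q).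
Proof. by rewrite /power_sum big_ord_recr. Qed.

Lemma ler_power_sum (R : realType) (q : R) m n :
  (m <= n)%N -> power_sum q m <= power_sum q n.
Proof.
move=> mn; rewrite -(subnK mn); elim: (n - m)%N => [|i IH] //.
by rewrite addSn power_sumS (le_trans IH) // lerDl powR_ge0.
Qed.

(** Discrete counterpart of integrating s^(-q). The induction step amounts to n^(1 - q) * (n + 1)^q
    <= n + q, an instance of weighted AM-GM. *)
Lemma power_sum_le (R : realType) (q : R) n : 0 < q < 1 ->
  power_sum q n <= n%:R `^ (1 - q) / (1 - q).
Proof.
move=> /andP[q0 q1]; have p0 : 0 < 1 - q by rewrite subr_gt0.
elim: n => [|n IH]; first by rewrite /power_sum big_ord0 divr_ge0 ?powR_ge0 // ltW.
rewrite power_sumS (le_trans (lerD IH (lexx _))) // ler_pdivlMr // mulrDl divfK ?gt_eqF //.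
have n1 : (0 : R) < n.+1%:R by rewrite ltr0n.
rewrite (@powRB _ n.+1%:R) ?(gt_eqF n1) ?implybT // powRr1 ?(ltW n1) // powRN.
have e0 : 0 < n.+1%:R `^ q :> R by apply: powR_gt0.
rewrite ler_pdivlMr // mulrDl mulrAC mulVf ?gt_eqF // mul1r.
have := @weighted_AMGM R q n%:R n.+1%:R.
rewrite q0 (ltW q1) => /(_ isT (ler0n _ _) (ler0n _ _)).
rewrite -natr1; lra.
Qed.

Lemma power_sum1_le (R : realType) n : (0 < n)%N ->
  power_sum 1 n <= 1 + ln n%:R :> R.
Proof.
case: n => // n _; elim: n => [|n IH].
  by rewrite power_sumS /power_sum big_ord0 powR1 ln1 addr0 add0r.
rewrite power_sumS (le_trans (lerD IH (lexx _))) // -addrA lerD2l.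
have n1 : (0 : R) < n.+1%:R by rewrite ltr0n.
have n2 : (0 : R) < n.+2%:R by rewrite ltr0n.
rewrite powR_inv1 ?ler0n //.
(* The new term 1 / (n + 2) is at most -ln (1 - 1 / (n + 2)) = ln (n + 2) - ln (n + 1). *)
have := @le_ln1Dx R (- n.+2%:R^-1).
rewrite ltrN2 invf_lt1 // ltr1n => /(_ isT).
have -> : 1 - n.+2%:R^-1 = n.+1%:R / n.+2%:R :> R.
  have e : n.+2%:R = n.+1%:R + 1 :> R by rewrite natr1.
  rewrite e; move: (n.+1%:R : R) n1 => t t0.
  by field; rewrite gt_eqF // addr_gt0.
rewrite ln_div ?posrE //.
move: (ln n.+1%:R) (ln n.+2%:R) (n.+2%:R^-1) => x y z; lra.
Qed.

(** The sum is at most twice the larger term; this crude constant is valid for every a >= 0. *)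
Lemma powRD_le (R : realType) (a x y : R) : 0 <= a -> 0 <= x -> 0 <= y ->
  (x + y) `^ a <= 2 `^ a * (x `^ a + y `^ a).
Proof.
move=> a0; wlog xy : x y / x <= y => [W x0 y0|x0 y0].
  have [xy|/ltW yx] := leP x y; first exact: W.
  by rewrite addrC (addrC (x `^ a)); apply: W.
apply: (@le_trans _ _ (2 `^ a * y `^ a)).
  by rewrite -powRM // ge0_ler_powR ?nnegrE ?addr_ge0 ?mulr_ge0 //; lra.
by rewrite ler_wpM2l ?powR_ge0 // lerDr powR_ge0.
Qed.

(** * Euclidean norm and costs *)

Lemma seqmin_le (R : realType) (s : seq R) x : x \in s -> seqmin s <= x.
Proof. by move=> xs; rewrite /seqmin; exact: (@ge_bigmin_seq _ _ _ _ _ x xpredT id xs isT). Qed.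

Lemma seqmin_in (R : realType) (s : seq R) : s != [::] -> seqmin s \in s.
Proof.
rewrite /seqmin; case: s => // x s _ /=; set m := x.
have : forall t : seq R, \big[Num.min/m]_(y <- t) y \in m :: t.
  elim=> [|y t IH]; first by rewrite big_nil mem_head.
  rewrite big_cons minEle; case: ifP => _; first by rewrite !inE eqxx orbT.
  by move: IH; rewrite !inE => /orP[->|->]; rewrite ?orbT.
by move=> /(_ (x :: s)); rewrite !inE orbA orbb.
Qed.

Lemma le_seqmax (R : realType) (s : seq R) x : x \in s -> x <= seqmax s.
Proof. by move=> xs; rewrite /seqmax; exact: (@le_bigmax_seq _ _ _ _ _ x xpredT id xs isT). Qed.

Lemma enorm_ge0 (R : realType) d (x : 'rV[R]_d) : 0 <= enorm x.
Proof. exact: sqrtr_ge0. Qed.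

Lemma enormN (R : realType) d (x : 'rV[R]_d) : enorm (- x) = enorm x.
Proof. by congr Num.sqrt; apply: eq_bigr => i _; rewrite mxE sqrrN. Qed.

Lemma enormB (R : realType) d (x y : 'rV[R]_d) : enorm (x - y) = enorm (y - x).
Proof. by rewrite -enormN opprB. Qed.

Lemma enorm0 (R : realType) d : enorm (0 : 'rV[R]_d) = 0.
Proof. by rewrite /enorm big1 ?sqrtr0 // => i _; rewrite mxE expr0n. Qed.

Lemma enorm_eq0 (R : realType) d (x : 'rV[R]_d) : enorm x = 0 -> x = 0.
Proof.
move=> /eqP; rewrite sqrtr_eq0 => x0; apply/rowP => i; rewrite mxE.
apply/eqP; rewrite -sqrf_eq0; apply/eqP/le_anti; rewrite sqr_ge0 andbT.
by apply: le_trans x0; rewrite (bigD1 i) //= lerDl sumr_ge0 // => j _; apply: sqr_ge0.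
Qed.

Lemma sqr_enorm (R : realType) d (x : 'rV[R]_d) :
  enorm x ^+ 2 = \sum_(i < d) x ord0 i ^+ 2.
Proof. by rewrite sqr_sqrtr // sumr_ge0 // => i _; apply: sqr_ge0. Qed.

Lemma ler_enormD (R : realType) d (x y : 'rV[R]_d) :
  enorm (x + y) <= enorm x + enorm y.
Proof.
(* Cauchy-Schwarz is Hoelder's inequality at p = 1 / 2, applied to the squared coordinates. *)
have CS : \sum_(i < d) x ord0 i * y ord0 i <= enorm x * enorm y.
  have h : 0 < (2^-1 : R) <= 1 by apply/andP; split; lra.
  have := power_mean (index_enum 'I_d) xpredT h
    (fun i => sqr_ge0 (x ord0 i)) (fun i => sqr_ge0 (y ord0 i)).
  have -> : 1 - 2^-1 = 2^-1 :> R by lra.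
  rewrite !powR12_sqrt ?sumr_ge0 //; try by move=> i _; apply: sqr_ge0.
  apply: le_trans; apply: ler_sum => i _.
  by rewrite !powR12_sqrt ?sqr_ge0 // !sqrtr_sqr -normrM ler_norm.
rewrite -(@ler_pXn2r _ 2) ?nnegrE ?addr_ge0 ?enorm_ge0 //.
rewrite sqrrD !sqr_enorm.
under eq_bigr do rewrite mxE sqrrD.
by rewrite !big_split /= lerD2r lerD2l mulr2n lerD.
Qed.

Lemma powdist_le (R : realType) d b (x c : 'rV[R]_d) T :
  c \in T -> powdist b x T <= enorm (x - c) `^ b.
Proof. by move=> cT; apply/seqmin_le/map_f. Qed.

Lemma powdist_in (R : realType) d b (x : 'rV[R]_d) T : T != [::] ->
  exists2 c, c \in T & powdist b x T = enorm (x - c) `^ b.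
Proof.
move=> T0; have : powdist b x T \in [seq enorm (x - c) `^ b | c <- T].
  by apply: seqmin_in; case: T T0.
by move=> /mapP[c cT ->]; exists c.
Qed.

Lemma powdist_ge0 (R : realType) d b (x : 'rV[R]_d) T : 0 <= powdist b x T.
Proof.
have [->|T0] := eqVneq T [::]; first by rewrite /powdist /seqmin big_nil.
by have [c _ ->] := powdist_in b x T0; apply: powR_ge0.
Qed.

Lemma le_powdist (R : realType) d b (x : 'rV[R]_d) T U : T != [::] ->
  {subset T <= U} -> powdist b x U <= powdist b x T.
Proof.
by move=> T0 TU; have [c /TU cU ->] := powdist_in b x T0; apply: powdist_le.
Qed.

Lemma powdist1 (R : realType) d b (x c : 'rV[R]_d) :
  powdist b x [:: c] = enorm (x - c) `^ b.
Proof. by rewrite /powdist /seqmin big_cons big_nil /= minxx. Qed.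

Lemma powdist_gt0 (R : realType) d b (x : 'rV[R]_d) T :
  T != [::] -> x \notin T -> 0 < powdist b x T.
Proof.
move=> T0 xT; have [c cT ->] := powdist_in b x T0.
apply: powR_gt0; rewrite lt0r enorm_ge0 andbT; apply: contraNneq xT.
by move=> /enorm_eq0/eqP; rewrite subr_eq0 => /eqP->.
Qed.

(** The center that serves x is also a candidate for z. *)
Lemma powdist_triangle (R : realType) d b (x z : 'rV[R]_d) T : 0 <= b ->
  T != [::] ->
  powdist b z T <= 2 `^ b * (powdist b x T + enorm (x - z) `^ b).
Proof.
move=> b0 T0; have [c cT ->] := powdist_in b x T0.
apply: le_trans (powdist_le b z cT) _.
apply: le_trans (powRD_le b0 (enorm_ge0 _) (enorm_ge0 _)).
apply: ge0_ler_powR => //; rewrite ?nnegrE ?addr_ge0 ?enorm_ge0 //.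
have -> : z - c = (x - c) + (z - x) by rewrite [RHS]addrC subrKA.
by rewrite (enormB x z) ler_enormD.
Qed.

Lemma powdist_pow (R : realType) d b b' (x : 'rV[R]_d) T : 0 < b -> 
  T != [::] -> powdist b' x T <= powdist b x T `^ (b' / b).
Proof.
move=> b0 T0; have [c cT ->] := powdist_in b x T0.
by rewrite -powRrM mulrCA divff ?gt_eqF // mulr1; apply: powdist_le.
Qed.

Lemma cost_ge0 (R : realType) d b (C : {fset 'rV[R]_d}) T : 0 <= cost b C T.
Proof. by apply: sumr_ge0 => x _; apply: powdist_ge0. Qed.

Lemma le_cost (R : realType) d b (C : {fset 'rV[R]_d}) T U : T != [::] ->
  {subset T <= U} -> cost b C U <= cost b C T.
Proof. by move=> T0 TU; apply: ler_sum => x _; apply: le_powdist. Qed.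

(** Hoelder's inequality over the points of C. With b' = 2 and b = a it passes from alpha-costs to
    squared costs. *)
Lemma cost_pow (R : realType) d b b' (C : {fset 'rV[R]_d}) T :
  0 < b' <= b -> T != [::] ->
  cost b' C T <= #|` C|%:R `^ (1 - b' / b) * cost b C T `^ (b' / b).
Proof.
move=> /andP[b'0 b'b] T0; have b0 : 0 < b by apply: lt_le_trans b'b.
have p01 : 0 < b' / b <= 1 by rewrite divr_gt0 //= ler_pdivrMr // mul1r.
apply: le_trans (ler_sum _ (fun x _ => powdist_pow b' x b0 T0)) _.
rewrite /cost !big_seq_fsetE /= cardfE.
have := @power_mean_card R C xpredT _ (fun x => powdist b (val x) T) p01
  (fun x => powdist_ge0 _ _ _).
by [].
Qed.

(** * Expectations over the seeding *)

Lemma big_tupleS (R : Type) (idx : R) (op : Monoid.com_law idx) (T : finType)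
    n (F : n.+1.-tuple T -> R) :
  \big[op/idx]_(s : n.+1.-tuple T) F s
  = \big[op/idx]_(x : T) \big[op/idx]_(t : n.-tuple T) F [tuple of x :: t].
Proof.
rewrite pair_bigA /=.
rewrite (reindex (fun p : T * n.-tuple T => [tuple of p.1 :: p.2])) //=.
exists (fun s => (thead s, [tuple of behead s])) => [[x t] _ /=|s _ /=].
  by rewrite theadE; congr (_, _); apply: val_inj.
by rewrite -tuple_eta.
Qed.

Section Seeding.
Context (R : realType) (d : nat) (a : R) (X : {fset 'rV[R]_d}).
Implicit Types (F G : seq 'rV[R]_d -> R) (Z : seq 'rV[R]_d).

Let E k F := seeding_expectation k a X F.

Lemma seeding_pmf_ge0 Z : 0 <= seeding_pmf a X Z.
Proof.
elim: Z => //= z [|y Z] IH; first by rewrite invr_ge0.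
by rewrite mulr_ge0 ?divr_ge0 ?powdist_ge0 ?cost_ge0.
Qed.

Lemma seeding_pmf_cons z Z : Z != [::] -> seeding_pmf a X (z :: Z)
  = seeding_pmf a X Z * (powdist a z Z / cost a X Z).
Proof. by case: Z. Qed.

Lemma le_seeding_expectation k F G :
  (forall Z, size Z = k -> {subset Z <= X} -> F Z <= G Z) -> E k F <= E k G.
Proof.
move=> FG; apply: ler_sum => s _; rewrite ler_wpM2l ?seeding_pmf_ge0 //.
apply: FG; first by rewrite size_map size_tuple.
by move=> _ /mapP[x _ ->]; apply: valP.
Qed.

Lemma eq_seeding_expectation k F G : F =1 G -> E k F = E k G.
Proof. by move=> FG; apply: eq_bigr => s _; rewrite FG. Qed.

Lemma seeding_expectationD k F G :
  E k (fun Z => F Z + G Z) = E k F + E k G.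
Proof. by rewrite -big_split /=; apply: eq_bigr => s _; rewrite mulrDr. Qed.

Lemma seeding_expectationZ k c F : E k (fun Z => c * F Z) = c * E k F.
Proof. by rewrite mulr_sumr; apply: eq_bigr => s _; rewrite mulrCA. Qed.

Lemma seeding_expectation_sum k (I : finType) (F : I -> seq 'rV[R]_d -> R) :
  E k (fun Z => \sum_i F i Z) = \sum_i E k (F i).
Proof.
by rewrite exchange_big /=; apply: eq_bigr => s _; rewrite mulr_sumr.
Qed.

Lemma seeding_expectation1 F :
  E 1 F = #|` X|%:R^-1 * \sum_(x <- X) F [:: x].
Proof.
rewrite /E /seeding_expectation big_tupleS big_seq_fsetE /= mulr_sumr.
apply: eq_bigr => x _; rewrite (big_pred1 [tuple]) //=.
by move=> t; apply/esym/eqP; rewrite [t]tuple0 [RHS]tuple0.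
Qed.

(** The head of the list is the last draw, so peeling it off conditions on the first k centers. *)
Lemma seeding_expectationS k F : (0 < k)%N ->
  E k.+1 F = E k (fun Z => \sum_(z <- X) powdist a z Z / cost a X Z * F (z :: Z)).
Proof.
move=> k0; rewrite /E /seeding_expectation big_tupleS exchange_big /=.
apply: eq_bigr => s _; rewrite big_seq_fsetE mulr_sumr; apply: eq_bigr => x _.
have Z0 : [seq val z | z <- s] != [::].
  by rewrite -size_eq0 size_map size_tuple -lt0n.
by have /= -> := seeding_pmf_cons (val x) Z0; rewrite /= !mulrA.
Qed.

Lemma cost_gt0 Z : Z != [::] -> (size Z < #|` X|)%N -> 0 < cost a X Z.
Proof.
move=> Z0 ZX; have [x xX xZ] : exists2 x, x \in X & x \notin Z.
  apply/hasP; rewrite -[has _ _]negbK -all_predC; apply/negP => /allP XZ.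
  move: ZX; rewrite ltnNge => /negP; apply; apply: uniq_leq_size => // x.
  by move=> /XZ /=; rewrite negbK.
rewrite /cost (big_fsetD1 x) //=; apply: ltr_wpDr; last exact: powdist_gt0.
by apply: sumr_ge0 => y _; apply: powdist_ge0.
Qed.

(** The drift is weighted by unnormalized probabilities; the normalization is positive as long as
    fewer than |X| centers are drawn. The comparison starts at one center because the first draw is
    uniform. *)
Lemma seeding_supermartingale k F : (0 < k <= #|` X|)%N ->
  (forall Z, Z != [::] -> (size Z < k)%N -> {subset Z <= X} ->
    \sum_(z <- X) powdist a z Z * (F (z :: Z) - F Z) <= 0) ->
  E k F <= E 1 F.
Proof.
move=> /andP[]; elim: k => // [[|k]] // IH _ kX drift.
apply: le_trans (IH isT (ltnW kX) _) => [|Z Z0 Zk]; last first.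
  by apply: drift => //; apply: ltnW.
rewrite seeding_expectationS //; apply: le_seeding_expectation => Z Zk ZX.
have Z0 : Z != [::] by rewrite -size_eq0 Zk.
have c0 : 0 < cost a X Z by rewrite cost_gt0 // Zk.
rewrite -subr_le0 -(pmulr_lle0 _ c0) mulrBl mulr_suml.
have -> : F Z * cost a X Z = \sum_(z <- X) powdist a z Z * F Z.
  by rewrite -mulr_suml mulrC.
rewrite -sumrB; apply: le_trans (drift Z Z0 _ ZX); last by rewrite Zk.
rewrite le_eqVlt; apply/orP; left; apply/eqP; apply: eq_bigr => z _.
by rewrite mulrBr mulrAC divfK // gt_eqF.
Qed.

(** Jensen's inequality for a concave power, read off Hoelder's inequality with the probabilities as
    weights. *)
Lemma seeding_expectation_powR k p F : (0 < k <= #|` X|)%N -> 0 < p <= 1 ->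
  (forall Z, 0 <= F Z) -> E k (fun Z => F Z `^ p) <= E k F `^ p.
Proof.
move=> kX p01 F0; have /andP[p0 p1] := p01.
(* The constant 1 has zero drift, which reduces the total mass to that of the first draw. *)
have mass : E k (fun=> 1) <= 1.
  apply: le_trans (seeding_supermartingale kX _) _ => [Z _ _ _|].
    by rewrite subrr -mulr_suml mulr0.
  rewrite seeding_expectation1 big_const_seq count_predT iter_addr_0.
  by rewrite mulVf // pnatr_eq0 -lt0n; case/andP: kX; apply: leq_trans.
have pF (s : k.-tuple X) : 0 <= seeding_pmf a X [seq val z | z <- s]
    * F [seq val z | z <- s] by rewrite mulr_ge0 ?seeding_pmf_ge0.
have pm := @power_mean R _ (index_enum (k.-tuple X)) xpredT p
  (fun s => seeding_pmf a X [seq val z | z <- s])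
  (fun s => seeding_pmf a X [seq val z | z <- s] * F [seq val z | z <- s])
  p01 (fun s => seeding_pmf_ge0 _) pF.
apply: le_trans (le_trans _ pm) _; last first.
  rewrite -[leRHS]mul1r ler_wpM2r ?powR_ge0 //.
  apply: (@le_trans _ _ (1 `^ (1 - p))); last by rewrite powR1.
  rewrite ge0_ler_powR ?nnegrE ?subr_ge0 //.
    by apply: sumr_ge0 => s _; apply: seeding_pmf_ge0.
  by apply: le_trans mass; apply: ler_sum => s _; rewrite mulr1.
apply: ler_sum => s _; rewrite powRM ?seeding_pmf_ge0 // mulrA ler_wpM2r ?powR_ge0 //.
set m := seeding_pmf _ _ _; have m0 : 0 <= m by apply: seeding_pmf_ge0.
have [->|mn0] := eqVneq m 0; first by rewrite mulr_ge0 ?powR_ge0.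
by rewrite -powRD ?mn0 ?implybT // subrK powRr1.
Qed.

End Seeding.

(** * Hit clusters *)

Section Clustering.
Context (R : realType) (d k : nat) (a : R) (X : {fset 'rV[R]_d}).
Context (C : 'I_k -> {fset 'rV[R]_d}).
Implicit Types (Z : seq 'rV[R]_d) (S : {set 'I_k}) (q : R).

Definition hit Z j := has (mem (C j)) Z.

(** This is the A_j of the outline. *)
Definition mean_pairwise_cost j : R :=
  #|` C j|%:R^-1 * \sum_(z <- C j) cost a (C j) [:: z].

(* Every cluster is charged its cost at the moment it is first hit.  Unlike the
   current cost of the hit clusters, which it dominates, this never decreases. *)
Fixpoint first_hit_cost Z : R :=
  if Z is z :: Z' then first_hit_cost Z'
    + \sum_(j | (z \in C j) && ~~ hit Z' j) cost a (C j) Z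
  else 0.

Lemma first_hit_cost_ge0 Z : 0 <= first_hit_cost Z.
Proof.
by elim: Z => //= z Z IH; rewrite addr_ge0 ?sumr_ge0 // => j _; apply: cost_ge0.
Qed.

Lemma hit_neq0 Z j : hit Z j -> Z != [::].
Proof. by case: Z. Qed.

(** Costs only fall as centers are added, so the charge of a cluster hit earlier still covers its
    current cost; a newly hit cluster is charged exactly its cost. *)
Lemma hit_cost_le Z : \sum_(j | hit Z j) cost a (C j) Z <= first_hit_cost Z.
Proof.
elim: Z => [|z Z IH]; first by rewrite big_pred0.
rewrite (bigID (hit Z)) /= lerD //.
  apply: le_trans IH; rewrite (eq_bigl (hit Z)); last first.
    by move=> j; rewrite /hit /=; case: (has _ Z); rewrite ?andbF ?orbT.
  apply: ler_sum => j /hit_neq0 Z0; apply: le_cost => // x xZ.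
  by rewrite inE xZ orbT.
rewrite le_eqVlt; apply/orP; left; apply/eqP; apply: eq_bigl => j.
by rewrite /hit /=; case: (has _ Z); rewrite ?andbF ?orbF.
Qed.

(** Summing the relaxed triangle inequality over the points of the cluster bounds the weight of z by
    the costs for Z and for z alone. The cost after adding z is at most either of these, so each of
    the two products is at most their product; hence the factor 2. *)
Lemma self_sampling_cost j Z : 0 <= a -> Z != [::] -> C j != fset0 ->
  \sum_(z <- C j) powdist a z Z * cost a (C j) (z :: Z)
  <= 2 * 2 `^ a * mean_pairwise_cost j * cost a (C j) Z.
Proof.
move=> a0 Z0 C0; have n0 : (0 : R) < #|` C j|%:R by rewrite ltr0n cardfs_gt0.
have tri z : #|` C j|%:R * powdist a z Z
    <= 2 `^ a * (cost a (C j) Z + cost a (C j) [:: z]).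
  rewrite /cost -big_split /= mulr_sumr mulr_natl.
  rewrite -[in leLHS](count_predT (C j)) -[_ *+ _]addr0 -iter_addr -big_const_seq.
  by apply: ler_sum => x _; rewrite powdist1; apply: powdist_triangle.
rewrite -(ler_pM2l n0) /mean_pairwise_cost.
have -> : #|` C j|%:R * (2 * 2 `^ a * (#|` C j|%:R^-1
      * \sum_(z <- C j) cost a (C j) [:: z]) * cost a (C j) Z)
    = \sum_(z <- C j) 2 * 2 `^ a * cost a (C j) Z * cost a (C j) [:: z].
  by rewrite -mulr_sumr; field; rewrite gt_eqF.
rewrite mulr_sumr; apply: ler_sum => z _; rewrite mulrA.
have c0 := cost_ge0 a (C j) Z; have c1 := cost_ge0 a (C j) [:: z].
have c2 := cost_ge0 a (C j) (z :: Z).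
have le1 : cost a (C j) (z :: Z) <= cost a (C j) [:: z].
  by apply: le_cost => // x; rewrite !inE => ->.
have le2 : cost a (C j) (z :: Z) <= cost a (C j) Z.
  by apply: le_cost => // x xZ; rewrite inE xZ orbT.
apply: le_trans (ler_wpM2r c2 (tri z)) _.
rewrite -!mulrA [leRHS]mulrCA ler_wpM2l ?powR_ge0 // mulrDl mulr_natl mulr2n.
by rewrite lerD // ?ler_wpM2l // mulrC ler_wpM2r.
Qed.

Hypothesis CX : is_clustering X C.

Lemma big_clustering (F : 'rV[R]_d -> R) :
  \sum_(x <- X) F x = \sum_j \sum_(x <- C j) F x.
Proof.
have [_ dis ->] := CX.
have enumK : perm_eq (index_enum 'I_k) [fset j | j in 'I_k]%fset.
  by apply: uniq_perm; rewrite ?index_enum_uniq ?fset_uniq // => j; rewrite mem_index_enum !inE.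
rewrite (eq_bigl xpredT) // !(perm_big _ enumK) /=.
by apply: partition_disjoint_bigfcup => i j _ _; apply: dis.
Qed.

Lemma mem_clusters x : x \in X -> exists j, x \in C j.
Proof.
have [_ _ ->] := CX; move=> /bigfcupP[j _ xj]; by exists j.
Qed.

Lemma mem_cluster_eq z i j : z \in C j -> (z \in C i) = (i == j).
Proof.
have [_ dis _] := CX => zj; have [->//|ij] := eqVneq i j.
apply/negP => zi; have := dis i j ij.
by move=> /fdisjointP /(_ _ zi); rewrite zj.
Qed.

Lemma hit_cons z Z i j : z \in C j -> hit (z :: Z) i = (i == j) || hit Z i.
Proof. by move=> zj; rewrite /hit /= (mem_cluster_eq _ zj). Qed.

Lemma first_hit_cost_cons z Z j : z \in C j ->
  first_hit_cost (z :: Z) = first_hit_cost Z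
    + (if hit Z j then 0 else cost a (C j) (z :: Z)).
Proof.
move=> zj /=; congr (_ + _).
under eq_bigl do rewrite (mem_cluster_eq _ zj).
case: ifP => hj; last by rewrite (big_pred1 j) // => i /=; case: eqP => // ->; rewrite hj.
by rewrite big_pred0 // => i; case: eqP => // ->; rewrite hj.
Qed.

(* The number of centers picked in a cluster that was already hit. *)
Definition wasted Z : nat := (size Z - #|hit Z|)%N.

Lemma card_hit_cons z Z j : z \in C j ->
  #|hit (z :: Z)| = (~~ hit Z j + #|hit Z|)%N.
Proof.
have memE Y i : (i \in hit Y) = hit Y i by [].
move=> zj; rewrite (cardD1 j) (cardD1 j (hit Z)) !memE (hit_cons _ _ zj).
rewrite eqxx /= addnA; case hj: (hit Z j) => /=; congr (_ + _)%N;
  by apply: eq_card => i; rewrite !inE !memE (hit_cons _ _ zj); case: eqP.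
Qed.

(** This makes the truncated subtraction in [wasted] exact. *)
Lemma card_hit_le Z : {subset Z <= X} -> (#|hit Z| <= size Z)%N.
Proof.
elim: Z => [|z Z IH] ZX; first by rewrite eq_card0.
have [j zj] := mem_clusters (ZX z (mem_head _ _)).
rewrite (card_hit_cons _ zj) /= -[leqRHS]add1n leq_add ?leq_b1 // IH // => x xZ.
by apply: ZX; rewrite inE xZ orbT.
Qed.

Lemma wasted_cons z Z j : {subset Z <= X} -> z \in C j ->
  wasted (z :: Z) = (hit Z j + wasted Z)%N.
Proof.
move=> ZX zj; rewrite /wasted (card_hit_cons _ zj) /=.
by have := card_hit_le ZX; case: (hit Z j) => /=; lia.
Qed.

Lemma card_clustering : #|` X|%:R = \sum_j #|` C j|%:R :> R.
Proof.
have := big_clustering (fun=> 1); rewrite big_const_seq count_predT iter_addr_0.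
by move=> ->; apply: eq_bigr => j _; rewrite big_const_seq count_predT iter_addr_0.
Qed.

Lemma num_clusters_le : (k <= #|` X|)%N.
Proof.
have [C0 _ _] := CX.
rewrite -(ler_nat R) card_clustering -natr_sum ler_nat.
rewrite -[leqLHS](card_ord k) -sum1_card; apply: leq_sum => j _.
by rewrite cardfs_gt0.
Qed.

End Clustering.

(** * Supermartingales of the seeding *)

Section Drift.
Context (R : realType) (d k : nat) (a : R) (X : {fset 'rV[R]_d}).
Context (C : 'I_k -> {fset 'rV[R]_d}).
Hypotheses (CX : is_clustering X C) (k0 : (0 < k)%N) (a0 : 0 < a).
Implicit Types (Z : seq 'rV[R]_d) (S : {set 'I_k}) (q : R).

Local Notation E := (seeding_expectation k a X).
Local Notation fhc := (first_hit_cost a C).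
Local Notation mpc := (mean_pairwise_cost a C).
Local Notation hit := (hit C).
Local Notation wasted := (wasted C).

Let kX : (0 < k <= #|` X|)%N.
Proof. by rewrite k0 (num_clusters_le CX). Qed.

Lemma mean_pairwise_cost_ge0 j : 0 <= mpc j.
Proof. by rewrite mulr_ge0 ?invr_ge0 // sumr_ge0 // => z _; apply: cost_ge0. Qed.

Lemma expected_first_hit_cost :
  E fhc <= 2 * 2 `^ a * \sum_j mpc j.
Proof.
have [C0 _ _] := CX.
set c := 2 * 2 `^ a; set A := \sum_j mpc j.
have c1 : 1 <= c.
  have : 1 <= 2 `^ a by rewrite -[leLHS](powRr0 2) ler_powR ?ler1n // ltW.
  by rewrite /c; lra.
(* Every unhit cluster holds a deposit of c * A_j, which covers the expected charge of its first
   hit. *)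
pose T Z := fhc Z + c * \sum_(j | ~~ hit Z j) mpc j.
have unhit_cons z Z j : z \in C j ->
    \sum_(i | ~~ hit (z :: Z) i) mpc i
    = \sum_(i | ~~ hit Z i) mpc i - (if hit Z j then 0 else mpc j).
  move=> zj; under eq_bigl do rewrite (hit_cons CX _ _ zj) negb_or.
  case: ifPn => hj.
    rewrite subr0; apply: eq_bigl => i; case: eqP => // ->.
    by rewrite hj.
  by rewrite [in RHS](bigD1 j) //= [RHS]addrAC subrr add0r; apply: eq_bigl => i; rewrite andbC.
have drift : E T <= seeding_expectation 1 a X T.
  apply: seeding_supermartingale => // Z Z0 _ ZX.
  rewrite (big_clustering CX); apply: sumr_le0 => j _.
  have [hj|hj] := boolP (hit Z j).
    rewrite big_seq big1 // => z zj.
    by rewrite /T (unhit_cons _ _ _ zj) (first_hit_cost_cons _ CX _ zj) hj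
      addr0 subr0 subrr mulr0.
  under eq_big_seq => z zj.
    rewrite /T (unhit_cons _ _ _ zj) (first_hit_cost_cons _ CX _ zj) (negbTE hj).
    rewrite (_ : _ - _ = cost a (C j) (z :: Z) - c * mpc j); last by ring.
    rewrite mulrBr.
    over.
  rewrite sumrB subr_le0 -mulr_suml [leRHS]mulrC.
  exact: self_sampling_cost (ltW a0) Z0 (C0 j).
apply: le_trans (_ : E T <= _).
  apply: le_seeding_expectation => Z _ _; rewrite lerDl mulr_ge0 //; first by lra.
  by apply: sumr_ge0 => j _; apply: mean_pairwise_cost_ge0.
apply: le_trans drift _.
have nX : (0 : R) < #|` X|%:R by rewrite ltr0n; case/andP: kX; apply: leq_trans.
(* After a uniform first center in C_j the expected value is A_j + c * (A - A_j), at most c * A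
   because c >= 1. *)
rewrite seeding_expectation1 ler_pdivrMl // (big_clustering CX).
rewrite (card_clustering CX) mulr_suml; apply: ler_sum => j _.
have n0 : (0 : R) < #|` C j|%:R by rewrite ltr0n cardfs_gt0.
under eq_big_seq => z zj.
  rewrite /T (unhit_cons _ _ _ zj) (first_hit_cost_cons _ CX _ zj) /=.
  rewrite add0r.
  over.
rewrite big_split /= big_const_seq count_predT iter_addr_0 -/A.
have -> : \sum_(z <- C j) cost a (C j) [:: z] = #|` C j|%:R * mpc j.
  by rewrite /mean_pairwise_cost mulrA mulfV ?gt_eqF // mul1r.
rewrite -(mulr_natl (c * _)) -mulrDr ler_wpM2l // mulrBr.
have := ler_wpM2r (mean_pairwise_cost_ge0 j) c1; rewrite mul1r; lra.
Qed.

Section Potential.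
Context (S : {set 'I_k}) (q : R).
Hypothesis q01 : 0 < q <= 1.

Definition unhit Z : {set 'I_k} := [set j in S | ~~ hit Z j].

Definition unhit_cost Z : R := \sum_(j in unhit Z) cost a (C j) Z `^ q.

(* The cost to be paid if wasted Z of the unhit clusters of S, chosen uniformly
   at random, were never to be hit. *)
Definition potential Z : R :=
  if (wasted Z < #|unhit Z|)%N then
    (wasted Z)%:R / #|unhit Z|%:R * unhit_cost Z
  else unhit_cost Z.

(* A waste, or a first hit in S, lowers #|unhit Z| - wasted Z by one as long as
   this (truncated) difference is positive; no other step changes it. *)
Definition waste_budget Z : R :=
  fhc Z `^ q * (power_sum q #|S| - power_sum q (#|unhit Z| - wasted Z)).

Lemma unhit_cost_ge0 Z : 0 <= unhit_cost Z.
Proof. by apply: sumr_ge0 => j _; apply: powR_ge0. Qed.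

Lemma card_unhit_le Z : (#|unhit Z| <= #|S|)%N.
Proof. by rewrite subset_leq_card //; apply/fintype.subsetP => j; rewrite inE => /andP[]. Qed.

(** H stands for the current cost of the hit clusters and M for the first-hit cost. Hoelder's
    inequality over the unhit clusters gives y <= u^(1 - q) * B^q, and weighted AM-GM gives H^(1 -
    q) * B^q <= H + B. *)
Lemma waste_rate Z (H M : R) : 0 <= H <= M -> (0 < #|unhit Z|)%N ->
  H * (unhit_cost Z / #|unhit Z|%:R)
  <= M `^ q * #|unhit Z|%:R `^ (- q) * (H + \sum_(j in unhit Z) cost a (C j) Z).
Proof.
have /andP[q0 q1] := q01; move=> /andP[H0 HM] u0.
set u := #|unhit Z|; set B := \sum_(j in unhit Z) cost a (C j) Z.
have B0 : 0 <= B by apply: sumr_ge0 => j _; apply: cost_ge0.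
have un0 : (0 : R) < u%:R by rewrite ltr0n.
have yB : unhit_cost Z <= u%:R `^ (1 - q) * B `^ q.
  by apply: power_mean_card => // j; apply: cost_ge0.
have yuB : unhit_cost Z / u%:R <= u%:R `^ (- q) * B `^ q.
  have uE : u%:R `^ (1 - q) = u%:R `^ (- q) * u%:R :> R.
    by rewrite -[X in _ * X]powRr1 // -powRD ?(gt_eqF un0) ?implybT // addrC.
  by rewrite ler_pdivrMr // mulrAC -uE.
apply: le_trans (ler_wpM2l H0 yuB) _.
have HB : H * B `^ q <= H `^ q * (H + B).
  have [->|Hn0] := eqVneq H 0; first by rewrite mul0r mulr_ge0 ?powR_ge0 ?addr_ge0.
  have HE : H = H `^ q * H `^ (1 - q).
    by rewrite -powRD ?Hn0 ?implybT // addrC subrK powRr1.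
  rewrite {1}HE -mulrA ler_wpM2l ?powR_ge0 //.
  by apply: le_trans (weighted_AMGM q01 H0 B0) _; nra.
rewrite mulrCA (mulrC (M `^ q)) -[leRHS]mulrA ler_wpM2l ?powR_ge0 //.
apply: le_trans HB _; rewrite ler_wpM2r ?addr_ge0 //.
by rewrite ge0_ler_powR ?nnegrE // ?(ltW q0) ?(le_trans H0).
Qed.

End Potential.
End Drift.

(** * Change of the potential in one step *)

Section PotentialDrift.
Context (R : realType) (d k : nat) (a : R) (X : {fset 'rV[R]_d}).
Context (C : 'I_k -> {fset 'rV[R]_d}) (S : {set 'I_k}) (q : R).
Hypothesis CX : is_clustering X C.
Hypothesis q01 : 0 < q <= 1.

Local Notation fhc := (first_hit_cost a C).
Local Notation hit := (hit C).
Local Notation wasted := (wasted C).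
Local Notation unhit := (unhit C S).
Local Notation unhit_cost := (unhit_cost a C S q).
Local Notation potential := (potential a C S q).
Local Notation waste_budget := (waste_budget a C S q).

Lemma unhit_cons z Z j : z \in C j -> unhit (z :: Z) = unhit Z :\ j.
Proof.
move=> zj; apply/setP => i; rewrite !inE (hit_cons CX _ _ zj) negb_or.
by rewrite andbCA.
Qed.

Lemma unhit_cost_cons z Z j : Z != [::] -> z \in C j ->
  unhit_cost (z :: Z) <= \sum_(i in unhit Z :\ j) cost a (C i) Z `^ q.
Proof.
move=> Z0 zj; rewrite /unhit_cost (unhit_cons _ zj); apply: ler_sum => i _.
have /andP[q0 _] := q01.
rewrite ge0_ler_powR ?nnegrE ?cost_ge0 ?(ltW q0) //.
by apply: le_cost => // x xZ; rewrite inE xZ orbT.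
Qed.

Lemma unhit_cost_cons_le z Z j : Z != [::] -> z \in C j ->
  unhit_cost (z :: Z) <= unhit_cost Z.
Proof.
move=> Z0 zj; apply: le_trans (unhit_cost_cons Z0 zj) _.
rewrite [leRHS](bigID (fun i => i != j)) /=.
rewrite (eq_bigl (fun i => (i \in unhit Z) && (i != j))); last first.
  by move=> i; rewrite in_setD1 andbC.
by rewrite lerDl sumr_ge0 // => i _; apply: powR_ge0.
Qed.

(** The first-hit cost never decreases and its cofactor is nonnegative, so the old value may stand
    in for the new one. *)
Lemma waste_budget_cons z Z j : z \in C j ->
  fhc Z `^ q * (power_sum q #|S| - power_sum q (#|unhit (z :: Z)| - wasted (z :: Z)))
  <= waste_budget (z :: Z).
Proof.
have /andP[q0 _] := q01.
move=> zj; rewrite /waste_budget ler_wpM2r //.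
  by rewrite subr_ge0 ler_power_sum // (leq_trans (leq_subr _ _)) // card_unhit_le.
rewrite ge0_ler_powR ?nnegrE ?first_hit_cost_ge0 ?(ltW q0) //.
rewrite (first_hit_cost_cons _ CX _ zj) lerDl.
by case: ifP => // _; apply: cost_ge0.
Qed.

(** Depends on the new center only through its cluster, so that averaging over the next center
    becomes a sum over clusters weighted by their costs. *)
Definition drift_bound Z j : R :=
  let u := #|unhit Z| in let w := wasted Z in
  if (w < u)%N then
    if hit Z j then unhit_cost Z / u%:R - fhc Z `^ q * u%:R `^ (- q)
    else if j \in S then
      w%:R / u.-1%:R * (unhit_cost Z - cost a (C j) Z `^ q)
      - w%:R / u%:R * unhit_cost Z - fhc Z `^ q * u%:R `^ (- q)
    else 0
  else 0.

(** The term removed from the power sum is (u - w)^(-q), which is at least u^(-q). *)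
Lemma budget_step u w M : (w < u)%N -> 0 <= M ->
  M * u%:R `^ (- q) <= M * (power_sum q (u - w) - power_sum q (u - w.+1)) :> R.
Proof.
have /andP[q0 _] := q01.
move=> wu M0; rewrite ler_wpM2l // -[(u - w)%N]prednK ?subn_gt0 // -subnS.
rewrite power_sumS addrAC subrr add0r subnS prednK ?subn_gt0 // !powRN.
have wu0 : (0 : R) < (u - w)%:R by rewrite ltr0n subn_gt0.
have u0 : (0 : R) < u%:R by rewrite ltr0n (leq_trans _ wu).
rewrite lef_pV2 ?posrE ?powR_gt0 //.
by rewrite ge0_ler_powR ?nnegrE ?ler0n ?(ltW q0) // ler_nat leq_subr.
Qed.

Lemma potential_cons z Z j : Z != [::] -> {subset Z <= X} -> z \in C j ->
  (potential (z :: Z) - waste_budget (z :: Z)) - (potential Z - waste_budget Z)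
  <= drift_bound Z j.
Proof.
move=> Z0 ZX zj; have M0 := powR_ge0 (fhc Z) q.
have Bz := waste_budget_cons Z zj; have yz := unhit_cost_cons Z0 zj.
have yz1 := unhit_cost_cons_le Z0 zj.
have y0 := unhit_cost_ge0 a C S q (z :: Z).
have y00 := unhit_cost_ge0 a C S q Z.
rewrite (unhit_cons _ zj) (wasted_cons CX ZX zj) in Bz.
rewrite opprB addrACA [_ - potential Z]addrC addrC /drift_bound.
have -> : waste_budget Z = fhc Z `^ q
    * (power_sum q #|S| - power_sum q (#|unhit Z| - wasted Z)) by [].
move: (waste_budget (z :: Z)) Bz => b Bz.
set u := #|unhit Z|; set w := wasted Z.
rewrite /potential (unhit_cons _ zj) (wasted_cons CX ZX zj) -/u -/w.
rewrite -/w in Bz.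
case hj: (hit Z j) Bz => /=.
  have -> : unhit Z :\ j = unhit Z.
    by apply/setP => i; rewrite !inE; case: eqP => // ->; rewrite hj andbF.
  rewrite -/u add1n => Bz.
  case: (ltnP w u) => wu.
    have u0 : (0 : R) < u%:R by rewrite ltr0n (leq_trans _ wu).
    have P1 : (if (w.+1 < u)%N then w.+1%:R / u%:R * unhit_cost (z :: Z)
        else unhit_cost (z :: Z)) <= w.+1%:R / u%:R * unhit_cost Z.
      case: ltnP => wu1; first by rewrite ler_wpM2l // divr_ge0.
      (* The potential changes branch here, but the factor w.+1 / u is 1, so the branches agree. *)
      have -> : w.+1 = u by apply/eqP; rewrite eqn_leq wu wu1.
      by rewrite divff ?gt_eqF // mul1r.
    have B1 := budget_step wu M0.
    have -> : unhit_cost Z / u%:R = w.+1%:R / u%:R * unhit_cost Z - w%:R / u%:R * unhit_cost Z.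
      by rewrite -mulrBl -mulrBl -natrB // subSnn mul1r mulrC.
    move: (power_sum q #|S|) (power_sum q (u - w)) (power_sum q (u - w.+1)) B1 Bz
      => G0 G1 G2 B1 Bz.
    move: (w.+1%:R / u%:R * unhit_cost Z) (w%:R / u%:R * unhit_cost Z)
      (if _ then _ else _) P1 => t1 t2 t3 P1.
    lra.
  rewrite ltnNge (leq_trans wu (leqnSn _)) /=.
  (* The truncated difference is 0 before and after the step, and the potential is the plain unhit
     cost, which cannot grow. *)
  have e1 : (u - w = 0)%N by apply/eqP.
  have e2 : (u - w.+1 = 0)%N by apply/eqP; rewrite subn_eq0 ltnW.
  rewrite e2 in Bz; rewrite e1; lra.
(* A first hit: outside S it changes neither u nor w, in S it lowers u by one. *)
rewrite add0n.
case jS: (j \in S); last first.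
  have -> : unhit Z :\ j = unhit Z.
    by apply/setP => i; rewrite !inE; case: eqP => // ->; rewrite jS.
  rewrite -/u => Bz; have P1 : (if (w < u)%N then w%:R / u%:R * unhit_cost (z :: Z)
      else unhit_cost (z :: Z)) <= (if (w < u)%N then w%:R / u%:R * unhit_cost Z
      else unhit_cost Z) by case: ifP => // _; rewrite ler_wpM2l // divr_ge0.
  have -> : (if (w < u)%N then 0 else 0) = 0 :> R by case: ifP.
  move: (power_sum q #|S|) (power_sum q (u - w)) Bz P1 => G0 G1 Bz.
  case: ifP => _; last by lra.
  move: (_ * unhit_cost (z :: Z)) (_ * unhit_cost Z) => t1 t2; lra.
have jU : j \in unhit Z by rewrite inE jS hj.
have uE : #|unhit Z :\ j| = u.-1 by rewrite /u (cardsD1 j (unhit Z)) jU.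
rewrite uE => Bz.
have yj : \sum_(i in unhit Z :\ j) cost a (C i) Z `^ q
    = unhit_cost Z - cost a (C j) Z `^ q.
  rewrite /unhit_cost [in RHS](bigD1 j) //= addrAC subrr add0r.
  by apply: eq_bigl => i; rewrite in_setD1 andbC.
rewrite yj in yz.
case: (ltnP w u) => wu; last first.
  have e1 : (u - w = 0)%N by apply/eqP.
  have e2 : (u.-1 - w = 0)%N by apply/eqP; rewrite subn_eq0 (leq_trans (leq_pred _)).
  rewrite ltnNge (leq_trans (leq_pred _) wu) /= e1; rewrite e2 in Bz; lra.
have P1 : (if (w < u.-1)%N then w%:R / u.-1%:R * unhit_cost (z :: Z)
    else unhit_cost (z :: Z)) <= w%:R / u.-1%:R * (unhit_cost Z - cost a (C j) Z `^ q).
  case: ltnP => wu1; first by rewrite ler_wpM2l // divr_ge0.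
  have -> : w = u.-1 by apply/eqP; rewrite eqn_leq wu1 andbT -ltnS prednK // (leq_trans _ wu).
  (* For u = 1 the factor is 0 / 0 = 0, but then no cluster of S remains unhit and the left side is
     0 as well. *)
  have [u1|u1] := eqVneq u.-1 0%N; last by rewrite divff ?mul1r // pnatr_eq0.
  rewrite u1 mul0r mul0r /unhit_cost big_pred0 // => i.
  by rewrite (unhit_cons _ zj); move/eqP: uE; rewrite u1 cards_eq0 => /eqP->; rewrite inE.
have B1 := budget_step wu M0.
have e : (u.-1 - w = u - w.+1)%N by rewrite -subn1 -subnDA add1n.
rewrite e in Bz; move: (power_sum q #|S|) (power_sum q (u - w))
  (power_sum q (u - w.+1)) B1 Bz => G0 G1 G2 B1 Bz.
move: P1; set t1 := (if _ then _ else _).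
move: t1 (_ * (unhit_cost Z - _)) (_ * unhit_cost Z) => t1 t2 t3.
lra.
Qed.

End PotentialDrift.

(** * Expected cost of the unhit clusters *)

Section UnhitCost.
Context (R : realType) (d k : nat) (a : R) (X : {fset 'rV[R]_d}).
Context (C : 'I_k -> {fset 'rV[R]_d}) (S : {set 'I_k}) (q : R).
Hypotheses (CX : is_clustering X C) (k0 : (0 < k)%N) (a0 : 0 < a).
Hypothesis q01 : 0 < q <= 1.

Local Notation E := (seeding_expectation k a X).
Local Notation fhc := (first_hit_cost a C).
Local Notation hit := (hit C).
Local Notation wasted := (wasted C).
Local Notation unhit := (unhit C S).
Local Notation unhit_cost := (unhit_cost a C S q).
Local Notation potential := (potential a C S q).
Local Notation waste_budget := (waste_budget a C S q).

(* A cluster of S is hit with probability proportional to its cost, so a first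
   hit does not increase, on average, the mean cost of the unhit clusters. *)
Lemma weighted_chebyshev Z : (wasted Z < #|unhit Z|)%N ->
  \sum_(j in unhit Z) cost a (C j) Z
     * ((wasted Z)%:R / #|unhit Z|.-1%:R * (unhit_cost Z - cost a (C j) Z `^ q)
        - (wasted Z)%:R / #|unhit Z|%:R * unhit_cost Z) <= 0.
Proof.
have /andP[q0 q1] := q01.
set u := #|unhit Z|; set w := wasted Z; set y := unhit_cost Z => wu.
pose B := \sum_(j in unhit Z) cost a (C j) Z.
pose D := \sum_(j in unhit Z) cost a (C j) Z * cost a (C j) Z `^ q.
have expand W1 W2 t : \sum_(j in unhit Z) cost a (C j) Z
      * (W1 * (t - cost a (C j) Z `^ q) - W2 * t) = W1 * (B * t - D) - W2 * (B * t).
  by rewrite /B /D mulr_suml -sumrB !mulr_sumr -sumrB; apply: eq_bigr => j _; ring.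
rewrite expand.
(* Costs and their q-th powers are ordered alike. This inequality is equivalent to (B * y - D) / (u
   - 1) <= B * y / u when u > 1. *)
have ByD : B * y <= u%:R * D.
  apply: chebyshev_sum => i j.
  have c0 l := cost_ge0 a (C l) Z.
  have [ij|/ltW ji] := leP (cost a (C i) Z) (cost a (C j) Z).
    by rewrite mulr_le0 // subr_le0 // ge0_ler_powR ?nnegrE ?(ltW q0).
  by rewrite mulr_ge0 // subr_ge0 // ge0_ler_powR ?nnegrE ?(ltW q0).
have u0 : (0 : R) < u%:R by rewrite ltr0n (leq_trans _ wu).
have [u1|u1] := posnP u.-1.
  have -> : w = 0%N by lia.
  by rewrite !mul0r subrr.
have v0 : (0 : R) < u.-1%:R by rewrite ltr0n.
have uE : u%:R = u.-1%:R + 1 :> R by rewrite natr1 prednK // lt0n; lia.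
rewrite subr_le0 -!mulrA ler_wpM2l // -(ler_pM2l (mulr_gt0 u0 v0)).
move: u0 ByD; rewrite uE; move: (u.-1%:R : R) v0 => v v0 u0 ByD.
have -> : (v + 1) * v * (v^-1 * (B * y - D)) = (v + 1) * (B * y - D).
  by field; rewrite gt_eqF.
have -> : (v + 1) * v * ((v + 1)^-1 * (B * y)) = v * (B * y).
  by field; rewrite gt_eqF.
move: (B * y) ByD => By ByD; lra.
Qed.

(** With r the budget spent per relevant step, the hit clusters contribute H * (y / u - r), and the
    unhit ones of S a nonpositive Chebyshev term minus B * r. The bound H * (y / u) <= r * (H + B)
    of [waste_rate] closes the balance. *)
Lemma potential_drift Z : Z != [::] -> {subset Z <= X} ->
  \sum_(z <- X) powdist a z Z * ((potential (z :: Z) - waste_budget (z :: Z))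
     - (potential Z - waste_budget Z)) <= 0.
Proof.
move=> Z0 ZX; rewrite (big_clustering CX).
apply: (@le_trans _ _ (\sum_j cost a (C j) Z * drift_bound a C S q Z j)).
  apply: ler_sum => j _; rewrite mulr_suml big_seq [leRHS]big_seq.
  apply: ler_sum => z zj; rewrite ler_wpM2l ?powdist_ge0 //.
  exact: (potential_cons _ _ CX).
rewrite /drift_bound; case: ltnP => wu; last by rewrite big1 // => j _; rewrite mulr0.
have HM : 0 <= \sum_(j | hit Z j) cost a (C j) Z <= fhc Z.
  by rewrite sumr_ge0 ?hit_cost_le // => j _; apply: cost_ge0.
have := waste_rate a q01 HM (leq_ltn_trans (leq0n _) wu).
have := weighted_chebyshev wu.
set u := #|unhit Z|; set w := wasted Z; set r := fhc Z `^ q * u%:R `^ (- q).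
move: (unhit_cost Z) => y cheb rate.
rewrite (bigID (hit Z)) /=.
have -> : \sum_(j | hit Z j) cost a (C j) Z * (if hit Z j then y / u%:R - r
      else if j \in S then w%:R / u.-1%:R * (y - cost a (C j) Z `^ q)
        - w%:R / u%:R * y - r else 0)
    = (\sum_(j | hit Z j) cost a (C j) Z) * (y / u%:R - r).
  by rewrite mulr_suml; apply: eq_bigr => j ->.
have -> : \sum_(j | ~~ hit Z j) cost a (C j) Z * (if hit Z j then y / u%:R - r
      else if j \in S then w%:R / u.-1%:R * (y - cost a (C j) Z `^ q)
        - w%:R / u%:R * y - r else 0)
    = \sum_(j in unhit Z) cost a (C j) Z
        * (w%:R / u.-1%:R * (y - cost a (C j) Z `^ q) - w%:R / u%:R * y)
      - (\sum_(j in unhit Z) cost a (C j) Z) * r.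
  rewrite mulr_suml -sumrB (bigID (mem S)) /= [X in _ + X]big1 ?addr0; last first.
    by move=> j /andP[/negbTE-> /negbTE->]; rewrite mulr0.
  apply: eq_big => [j|j /andP[/negbTE-> ->]]; first by rewrite inE andbC.
  by rewrite mulrBr.
lra.
Qed.

(** With as many centers as clusters, the number of wasted centers equals the number of all unhit
    clusters, in S or not. *)
Lemma potential_final Z : size Z = k -> potential Z = unhit_cost Z.
Proof.
move=> Zk; rewrite /potential ltnNge.
suff -> : (#|unhit Z| <= wasted Z)%N by [].
rewrite /wasted Zk leq_subRL; last by rewrite -[leqRHS](card_ord k) max_card.
rewrite -[leqRHS](card_ord k) -(cardC (hit Z)) leq_add2l.
rewrite subset_leq_card //; apply/fintype.subsetP => j.
by rewrite !inE => /andP[_].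
Qed.

Lemma expected_unhit_cost :
  E unhit_cost <= power_sum q #|S| * E (fun Z => fhc Z `^ q).
Proof.
have [C0 _ _] := CX.
have budget_ge0 Z : 0 <= waste_budget Z.
  rewrite mulr_ge0 ?powR_ge0 // subr_ge0 ler_power_sum //.
  by rewrite (leq_trans (leq_subr _ _)) // card_unhit_le.
(* The first center is never wasted, so the potential starts at 0. *)
have start : seeding_expectation 1 a X (fun Z => potential Z - waste_budget Z) <= 0.
  rewrite seeding_expectation1 mulr_ge0_le0 ?invr_ge0 // big_seq sumr_le0 // => x xX.
  rewrite subr_le0 (le_trans _ (budget_ge0 _)) // /potential.
  have [j xj] := mem_clusters CX xX.
  rewrite (wasted_cons CX _ xj) //= /wasted sub0n addn0 /=.
  case: ltnP => u0; first by rewrite mul0r mul0r.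
  move: u0; rewrite leqn0 cards_eq0 /unhit_cost => /eqP->; by rewrite big_set0.
have kX : (0 < k <= #|` X|)%N by rewrite k0 (num_clusters_le CX).
have drift : E (fun Z => potential Z - waste_budget Z) <= 0.
  apply: le_trans start; apply: seeding_supermartingale => // Z Z0 _ ZX.
  by apply: potential_drift.
apply: (@le_trans _ _ (E waste_budget + E (fun Z => potential Z - waste_budget Z))).
  rewrite -seeding_expectationD; apply: le_seeding_expectation => Z Zk _.
  by rewrite addrC subrK potential_final.
rewrite -[leRHS]addr0 lerD // -seeding_expectationZ.
apply: le_seeding_expectation => Z _ _; rewrite [leRHS]mulrC /waste_budget ler_wpM2l ?powR_ge0 //.
by rewrite lerBlDr lerDl power_sum_ge0.
Qed.

End UnhitCost.

(** * Expected cost *)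

(** Absorbs the factor 1 / (1 - p) of the power sums. With t = a / 2 - 1 the claim reduces to t^p <=
    t + 1, by cases on t <= 1. *)
Lemma alpha_factor_ge (R : realType) (a : R) : 2 < a ->
  4 / (1 - 2 / a) <= alpha_factor a.
Proof.
move=> a2; have a0 : 0 < a by lra.
have t0 : 0 < a / 2 - 1 by lra.
have -> : 4 / (1 - 2 / a) = a ^+ 2 / (a / 2 * (a / 2 - 1)).
  by field; rewrite !gt_eqF //; lra.
have p0 : 0 < 2 / a by rewrite divr_gt0.
have p1 : 2 / a <= 1 by rewrite ler_pdivrMr //; lra.
rewrite /alpha_factor ler_wpM2l ?sqr_ge0 // lef_pV2 ?posrE ?powR_gt0 ?mulr_gt0 ?divr_gt0 //.
rewrite powRD ?(gt_eqF t0) ?implybT // powRr1 ?(ltW t0) // ler_wpM2r ?(ltW t0) //.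
have [t1|t1] := leP (a / 2 - 1) 1.
  apply: (@le_trans _ _ 1); last by lra.
  rewrite -[leRHS](powRr0 (a / 2 - 1)) ger_powR ?(ltW p0) //.
  by rewrite t0.
by apply: le_trans (ler1_powR (ltW t1) p1) _; lra.
Qed.

Lemma alpha_factor_le_sqr (R : realType) (a : R) : 4 <= a ->
  `|alpha_factor a| <= `|a ^+ 2|.
Proof.
move=> a4; have p0 : 0 <= 2 / a by rewrite divr_ge0 //; lra.
rewrite /alpha_factor normrM ler_piMr // normfV invf_le1 ?normr_gt0; last first.
  by rewrite gt_eqF // powR_gt0 //; lra.
rewrite ger0_norm ?powR_ge0 // -[leLHS](powRr0 (a / 2 - 1)) ler_powR //; lra.
Qed.

Lemma power_sum1_log (R : realType) k : (0 < k)%N ->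
  power_sum 1 k <= 3 * log_clusters R k /\ 1 <= 2 * log_clusters R k.
Proof.
(* From ln (1 / 2) <= -1 / 2; it lets the logarithm absorb the constant in 1 + ln k. *)
move=> k0; have L2 : 1 <= 2 * ln 2 :> R.
  have := @le_ln1Dx R (- 2^-1); have -> : 1 - 2^-1 = 2^-1 :> R by lra.
  rewrite lnV ?posrE // => /(_ _); lra.
have kL : ln k%:R <= log_clusters R k.
  by rewrite /log_clusters ler_ln ?posrE ?ltr0n ?(leq_trans _ (leq_maxr _ _)) // ler_nat leq_maxl.
have L2' : ln 2 <= log_clusters R k.
  by rewrite /log_clusters ler_ln ?posrE ?ltr0n ?(leq_trans _ (leq_maxr _ _)) // ler_nat leq_maxr.
split; last by lra.
by apply: le_trans (power_sum1_le R k0) _; lra.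
Qed.

Section Assembly.
Context (R : realType) (d k : nat) (a : R) (X : {fset 'rV[R]_d}).
Context (C : 'I_k -> {fset 'rV[R]_d}).
Hypotheses (CX : is_clustering X C) (k0 : (0 < k)%N) (a2 : 2 < a).

Local Notation E := (seeding_expectation k a X).
Local Notation fhc := (first_hit_cost a C).
Local Notation hit := (hit C).
Local Notation n := (#|` X|%:R).
Local Notation p := (2 / a).
Local Notation A := (\sum_j mean_pairwise_cost a C j).

Let a0 : 0 < a. Proof. by apply: lt_trans a2. Qed.
Let p0 : 0 < p. Proof. by rewrite divr_gt0. Qed.
Let p1 : p < 1. Proof. by rewrite ltr_pdivrMr // mul1r. Qed.
Let p01 : 0 < p <= 1. Proof. by rewrite p0 ltW. Qed.
Let q0 : 0 < 1 - p. Proof. by rewrite subr_gt0. Qed.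

Lemma clusters_power_mean (P : pred 'I_k) (b : 'I_k -> R) :
  (forall j, 0 <= b j) ->
  \sum_(j | P j) #|` C j|%:R `^ (1 - p) * b j `^ p
  <= n `^ (1 - p) * (\sum_(j | P j) b j) `^ p.
Proof.
move=> b0; apply: le_trans (power_mean _ _ p01 _ b0) _ => [j|]; first exact: ler0n.
rewrite ler_wpM2r ?powR_ge0 // ge0_ler_powR ?nnegrE ?(ltW q0) ?sumr_ge0 //.
by rewrite (card_clustering CX) [leRHS](bigID P) /= lerDl sumr_ge0.
Qed.

(** Hoelder's inequality is applied over the points of each cluster, then over the hit clusters with
    their sizes as weights. The unhit part is kept as a sum, to be bounded in two ways. *)
Lemma cost2_le Z : Z != [::] ->
  cost 2 X Z <= n `^ (1 - p) * fhc Z `^ p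
    + \sum_(j | ~~ hit Z j) #|` C j|%:R `^ (1 - p) * cost a (C j) Z `^ p.
Proof.
move=> Z0; rewrite /cost (big_clustering CX) -/(cost _ _ _).
apply: (@le_trans _ _ (\sum_j #|` C j|%:R `^ (1 - p) * cost a (C j) Z `^ p)).
  by apply: ler_sum => j _; apply: cost_pow; rewrite // (ltW a2) andbT.
rewrite (bigID (hit Z)) /= lerD2r.
apply: le_trans (clusters_power_mean _ _) _ => [j|]; first exact: cost_ge0.
rewrite ler_wpM2l ?powR_ge0 // ge0_ler_powR ?nnegrE ?(ltW p0) ?hit_cost_le //.
  by apply: sumr_ge0 => j _; apply: cost_ge0.
exact: first_hit_cost_ge0.
Qed.

Let A_ge0 : 0 <= A.
Proof. by apply: sumr_ge0 => j _; apply: mean_pairwise_cost_ge0. Qed.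

Lemma expected_first_hit_cost_ge0 : 0 <= E fhc.
Proof.
apply: sumr_ge0 => s _.
by rewrite mulr_ge0 ?seeding_pmf_ge0 ?first_hit_cost_ge0.
Qed.

Lemma first_hit_cost_powR : E fhc `^ p <= 8 * A `^ p.
Proof.
have c0 : (0 : R) <= 2 * 2 `^ a by rewrite mulr_ge0 ?powR_ge0.
apply: (@le_trans _ _ ((2 * 2 `^ a * A) `^ p)).
  rewrite ge0_ler_powR ?nnegrE ?(ltW p0) ?expected_first_hit_cost_ge0 ?mulr_ge0 ?A_ge0 ?powR_ge0 //.
  exact: expected_first_hit_cost.
rewrite powRM ?A_ge0 // ler_wpM2r ?powR_ge0 // powRM ?powR_ge0 // -powRrM.
(* The constant is 2^p * (2^a)^p = 2^p * 4 <= 8. *)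
have -> : a * p = 2 by rewrite mulrC divfK // gt_eqF.
have := @ler1_powR R 2 p; rewrite powR_mulrn // => /(_ _ _); rewrite (ltW p1); lra.
Qed.

Let kX : (0 < k <= #|` X|)%N.
Proof. by rewrite k0 (num_clusters_le CX). Qed.

Lemma expected_first_hit_cost_powR : E (fun Z => fhc Z `^ p) <= 8 * A `^ p.
Proof.
apply: le_trans first_hit_cost_powR.
by apply: seeding_expectation_powR kX p01 _ => Z; apply: first_hit_cost_ge0.
Qed.

(** The choice S = all clusters, q = 1. Hoelder's inequality over the clusters and Jensen's
    inequality reduce the claim to the expected alpha-cost of the unhit clusters. *)
Lemma expected_unhit_log :
  E (fun Z => \sum_(j | ~~ hit Z j) #|` C j|%:R `^ (1 - p) * cost a (C j) Z `^ p)
  <= 8 * (power_sum 1 k) `^ p * (n `^ (1 - p) * A `^ p).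
Proof.
have one01 : 0 < (1 : R) <= 1 by rewrite ltr01 lexx.
have y0 Z := unhit_cost_ge0 a C [set: 'I_k]%SET 1 Z.
apply: (@le_trans _ _ (E (fun Z => n `^ (1 - p) * unhit_cost a C [set: 'I_k]%SET 1 Z `^ p))).
  apply: le_seeding_expectation => Z _ _.
  apply: le_trans (clusters_power_mean _ _) _ => [j|]; first exact: cost_ge0.
  rewrite ler_wpM2l ?powR_ge0 // le_eqVlt; apply/orP; left; apply/eqP; congr (_ `^ _).
  apply: eq_big => [j|j _]; first by rewrite !inE.
  by rewrite powRr1 // cost_ge0.
rewrite seeding_expectationZ [leRHS]mulrCA ler_wpM2l ?powR_ge0 //.
have jensen := seeding_expectation_powR a kX p01 y0.
apply: le_trans jensen _.
have unhit_le := expected_unhit_cost [set: 'I_k]%SET CX k0 a0 one01.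
rewrite cardsT card_ord in unhit_le.
have e1 : E (fun Z => fhc Z `^ 1) = E fhc.
  by apply: eq_seeding_expectation => Z; rewrite powRr1 // first_hit_cost_ge0.
rewrite e1 in unhit_le.
apply: (@le_trans _ _ ((power_sum 1 k * E fhc) `^ p)).
  rewrite ge0_ler_powR ?nnegrE ?(ltW p0) ?mulr_ge0 ?power_sum_ge0 ?expected_first_hit_cost_ge0 //.
  by apply: sumr_ge0 => s _; rewrite mulr_ge0 ?seeding_pmf_ge0.
rewrite powRM ?power_sum_ge0 ?expected_first_hit_cost_ge0 // -mulrA mulrCA.
by rewrite ler_wpM2l ?powR_ge0 // first_hit_cost_powR.
Qed.

End Assembly.

(** * Grouping the clusters by size *)

Section Scales.
Context (R : realType) (d k : nat) (a : R) (X : {fset 'rV[R]_d}).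
Context (C : 'I_k -> {fset 'rV[R]_d}).
Hypotheses (CX : is_clustering X C) (k0 : (0 < k)%N) (a2 : 2 < a).

Local Notation E := (seeding_expectation k a X).
Local Notation fhc := (first_hit_cost a C).
Local Notation hit := (hit C).
Local Notation n := (#|` X|%:R).
Local Notation p := (2 / a).
Local Notation A := (\sum_j mean_pairwise_cost a C j).

Let a0 : 0 < a. Proof. by apply: lt_trans a2. Qed.
Let p0 : 0 < p. Proof. by rewrite divr_gt0. Qed.
Let p1 : p < 1. Proof. by rewrite ltr_pdivrMr // mul1r. Qed.
Let p01 : 0 < p <= 1. Proof. by rewrite p0 ltW. Qed.
Let q0 : 0 < 1 - p. Proof. by rewrite subr_gt0. Qed.

Let C0 j : (0 < #|` C j|)%N.
Proof. by have [C0 _ _] := CX; rewrite cardfs_gt0. Qed.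

Definition scale j : nat := trunc_log 2 #|` C j|.

Lemma scaleP j : (2 ^ scale j <= #|` C j| < 2 ^ (scale j).+1)%N.
Proof. exact: trunc_log_bounds. Qed.

Definition scale_bound : nat := (\max_j scale j).+1.

Definition scale_set (i : nat) : {set 'I_k} := [set j | scale j == i].

Lemma scale_setE i : #|scale_set i| = scale_count C i.
Proof.
apply: eq_card => j; rewrite !inE; apply/eqP/idP => [<-|]; first exact: scaleP.
exact: trunc_log_eq.
Qed.

Lemma big_scales (P : pred 'I_k) (F : 'I_k -> R) :
  \sum_(j | P j) F j
  = \sum_(i < scale_bound) \sum_(j | P j && (j \in scale_set i)) F j.
Proof.
rewrite (partition_big (fun j => inord (scale j) : 'I_scale_bound) xpredT) //=.
apply: eq_bigr => i _; apply: eq_bigl => j; rewrite inE -val_eqE /= inordK //.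
by rewrite ltnS leq_bigmax.
Qed.

Lemma nonempty_scales_le :
  (#|[pred i : 'I_scale_bound | (0 < #|scale_set i|)%N]| <= num_scales C)%N.
Proof.
(* [fset_set] is empty on infinite sets, so finiteness comes first. *)
have fin : finite_set [set i : nat | (0 < scale_count C i)%N]%classic.
  apply: (sub_finite_set _ (finite_II scale_bound)) => i /=.
  rewrite -scale_setE => /card_gt0P[j]; rewrite inE => /eqP<-.
  by rewrite /= ltnS leq_bigmax.
rewrite cardE -(size_map val); apply: uniq_leq_size.
  by rewrite map_inj_uniq ?enum_uniq //; apply: val_inj.
move=> _ /mapP[i + ->]; rewrite mem_enum inE scale_setE => i0.
by rewrite in_fset_set // inE.
Qed.

Lemma num_scales_gt0 : (0 < num_scales C)%N.
Proof.
apply: leq_trans nonempty_scales_le; apply/card_gt0P.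
pose j := Ordinal k0; exists (inord (scale j)); rewrite inE inordK.
  by apply/card_gt0P; exists j; rewrite inE.
by rewrite ltnS leq_bigmax.
Qed.

(** Hoelder's inequality over the nonempty scales. A cluster of scale i has at least 2^i points, so
    the weights add up to at most |X|. *)
Lemma sum_scale_powR :
  \sum_(i < scale_bound | (0 < #|scale_set i|)%N)
    ((2 ^ i)%:R * #|scale_set i|%:R) `^ (1 - p)
  <= n `^ (1 - p) * (num_scales C)%:R `^ p.
Proof.
have m0 (i : 'I_scale_bound) : 0 <= (2 ^ i)%:R * #|scale_set i|%:R :> R.
  by rewrite mulr_ge0.
have := power_mean (index_enum 'I_scale_bound)
  (fun i => (0 < #|scale_set i|)%N) p01 m0 (fun=> ler01).
under eq_bigr do rewrite powR1 mulr1.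
rewrite sumr_const => /le_trans; apply.
apply: ler_pM; rewrite ?powR_ge0 // ge0_ler_powR ?nnegrE ?(ltW q0) ?(ltW p0) //.
- by apply: sumr_ge0.
- rewrite (card_clustering CX) big_scales /= [leRHS](bigID
    (fun i : 'I_scale_bound => 0 < #|scale_set i|)%N) /=.
  rewrite -[leLHS]addr0 lerD //; last by apply: sumr_ge0 => i _; apply: sumr_ge0.
  apply: ler_sum => i _; rewrite mulr_natr -sumr_const; apply: ler_sum => j.
  by rewrite inE => /eqP<-; rewrite ler_nat; have /andP[] := scaleP j.
- by rewrite ler_nat nonempty_scales_le.
Qed.

Lemma scale_term (i : nat) :
  (2 ^ i.+1)%:R `^ (1 - p) * power_sum p #|scale_set i|
  <= 2 / (1 - p) * (if (0 < #|scale_set i|)%N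
       then ((2 ^ i)%:R * #|scale_set i|%:R) `^ (1 - p) else 0).
Proof.
case: posnP => [->|ki]; first by rewrite /power_sum big_ord0 !mulr0.
have pq : 0 < p < 1 by rewrite p0 p1.
apply: le_trans (ler_wpM2l (powR_ge0 _ _) (power_sum_le _ pq)) _.
rewrite [leRHS]mulrAC mulrA ler_wpM2r ?invr_ge0 ?(ltW q0) //.
rewrite expnS natrM !powRM // mulrA ler_wpM2r ?powR_ge0 // ler_wpM2r ?powR_ge0 //.
by apply: ler1_powR; rewrite ?ler1n // gerBl ltW.
Qed.

Lemma expected_unhit_scales :
  E (fun Z => \sum_(j | ~~ hit Z j) #|` C j|%:R `^ (1 - p) * cost a (C j) Z `^ p)
  <= 16 / (1 - p) * (num_scales C)%:R `^ p * (n `^ (1 - p) * A `^ p).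
Proof.
pose y (i : 'I_scale_bound) := unhit_cost a C (scale_set i) p.
(* Rounding the sizes up to 2^(i + 1) factors them out of each scale, at the price of a factor at
   most 2 in [scale_term]. *)
pose mid Z := \sum_(i < scale_bound) (2 ^ i.+1)%:R `^ (1 - p) * y i Z.
have step Z : \sum_(j | ~~ hit Z j) #|` C j|%:R `^ (1 - p) * cost a (C j) Z `^ p
    <= mid Z.
  rewrite big_scales.
  apply: ler_sum => i _; rewrite mulr_sumr.
  rewrite [leRHS](eq_bigl (fun j => ~~ hit Z j && (j \in scale_set i))); last first.
    by move=> j; rewrite inE andbC.
  apply: ler_sum => j /andP[_]; rewrite inE => /eqP si.
  rewrite ler_wpM2r ?powR_ge0 // ge0_ler_powR ?nnegrE ?(ltW q0) //.
  by rewrite ler_nat -si; have /andP[_ /ltnW] := scaleP j.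
apply: le_trans (le_seeding_expectation _ (G := mid) (fun Z _ _ => step Z)) _.
rewrite /mid seeding_expectation_sum.
pose H := E (fun Z => fhc Z `^ p).
have H0 : 0 <= H.
  by apply: sumr_ge0 => s _; rewrite mulr_ge0 ?seeding_pmf_ge0 ?powR_ge0.
apply: (@le_trans _ _ (\sum_(i < scale_bound) H * (2 / (1 - p) * (if (0 < #|scale_set i|)%N
       then ((2 ^ i)%:R * #|scale_set i|%:R) `^ (1 - p) else 0)))).
  apply: ler_sum => i _; rewrite seeding_expectationZ.
  have yi := expected_unhit_cost (scale_set i) CX k0 a0 p01.
  apply: le_trans (ler_wpM2l (powR_ge0 _ _) yi) _.
  by rewrite mulrA [leRHS]mulrC ler_wpM2r // scale_term.
rewrite -mulr_sumr -mulr_sumr -big_mkcond /=.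
apply: (@le_trans _ _ (8 * A `^ p * (2 / (1 - p) * (n `^ (1 - p) * (num_scales C)%:R `^ p)))).
  apply: ler_pM => //.
  - by rewrite mulr_ge0 ?divr_ge0 ?(ltW q0) // sumr_ge0 // => i _; apply: powR_ge0.
  - exact: expected_first_hit_cost_powR.
  - by rewrite ler_wpM2l ?divr_ge0 ?(ltW q0) // sum_scale_powR.
rewrite le_eqVlt; apply/orP; left; apply/eqP.
move: (A `^ p) (n `^ (1 - p)) ((num_scales C)%:R `^ p) (1 - p) q0 => u v w q qp.
by field; rewrite gt_eqF.
Qed.

End Scales.

(** * Comparison with the cost of the clustering *)

Lemma sqr_sigma (R : realType) d (D : {fset 'rV[R]_d}) :
  sigma D ^+ 2 = cost 2 D [:: mean D] / #|` D|%:R.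
Proof.
have -> : cost 2 D [:: mean D] = \sum_(x <- D) enorm (x - mean D) ^+ 2.
  by apply: eq_bigr => x _; rewrite powdist1 powR_mulrn ?enorm_ge0.
rewrite sqr_sqrtr; first by rewrite mulrC.
by rewrite mulr_ge0 ?invr_ge0 ?sumr_ge0 // => x _; apply: sqr_ge0.
Qed.

Section CostBound.
Context (R : realType) (d k : nat) (a : R) (X : {fset 'rV[R]_d}).
Context (C : 'I_k -> {fset 'rV[R]_d}).
Hypotheses (CX : is_clustering X C) (a2 : 2 < a) (sigma0 : 0 < sigma_min C).

Local Notation p := (2 / a).

Let a0 : 0 < a. Proof. by apply: lt_trans a2. Qed.
Let p0 : 0 < p. Proof. by rewrite divr_gt0. Qed.
Let p1 : p < 1. Proof. by rewrite ltr_pdivrMr // mul1r. Qed.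
Let q0 : 0 < 1 - p. Proof. by rewrite subr_gt0. Qed.
Let C0 j : (0 : R) < #|` C j|%:R.
Proof. by have [Cn0 _ _] := CX; rewrite ltr0n cardfs_gt0. Qed.

Lemma sigma_bounds j : 0 < sigma (C j) /\ sigma_min C <= sigma (C j) <= sigma_max C.
Proof.
have mj : sigma (C j) \in [seq sigma (C i) | i <- enum 'I_k].
  by apply/map_f; rewrite mem_enum.
have sj : sigma_min C <= sigma (C j) by apply: seqmin_le.
by split; [apply: lt_le_trans sj|rewrite sj le_seqmax].
Qed.

Lemma clustering_costE :
  clustering_cost C = \sum_j #|` C j|%:R * sigma (C j) ^+ 2.
Proof.
apply: eq_bigr => j _; rewrite sqr_sigma mulrC divfK ?gt_eqF //.
by apply: eq_bigr => x _; rewrite powdist1 powR_mulrn ?enorm_ge0.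
Qed.

(** The denominator in the concentration parameter is (sigma^2)^(a / 2) = sigma^a. *)
Lemma mean_pairwise_cost_le j :
  mean_pairwise_cost a C j <= concentration a C * (#|` C j|%:R * sigma (C j) `^ a).
Proof.
have [s0 _] := sigma_bounds j.
have gj : (#|` C j|%:R ^+ 2)^-1 * (\sum_(z <- C j) cost a (C j) [:: z])
    / (cost 2 (C j) [:: mean (C j)] / #|` C j|%:R) `^ (a / 2) <= concentration a C.
  by apply/le_seqmax/map_f; rewrite mem_enum.
move: gj; rewrite -sqr_sigma -powR_mulrn ?(ltW s0) // -powRrM mulrCA divff ?mulr1 //.
rewrite ler_pdivrMr ?powR_gt0 // => gj.
rewrite mulrCA; apply: le_trans (ler_wpM2l (ltW (C0 j)) gj).
rewrite /mean_pairwise_cost le_eqVlt; apply/orP; left; apply/eqP.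
by field; rewrite gt_eqF.
Qed.

Lemma concentration_ge0 (j : 'I_k) : 0 <= concentration a C.
Proof.
have gj := mean_pairwise_cost_le j; have [s0 _] := sigma_bounds j.
have ms : 0 < #|` C j|%:R * sigma (C j) `^ a by rewrite mulr_gt0 ?powR_gt0.
rewrite -(pmulr_lge0 _ ms); apply: le_trans gj.
exact: mean_pairwise_cost_ge0.
Qed.

Lemma sum_mean_pairwise_cost_le (j0 : 'I_k) :
  \sum_j mean_pairwise_cost a C j
  <= concentration a C * (sigma_max C `^ (a - 2) * clustering_cost C).
Proof.
apply: le_trans (ler_sum _ (fun j _ => mean_pairwise_cost_le j)) _.
rewrite -mulr_sumr ler_wpM2l ?(concentration_ge0 j0) // clustering_costE mulr_sumr.
apply: ler_sum => j _; rewrite [leRHS]mulrCA ler_wpM2l //.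
have [s0 /andP[_ sx]] := sigma_bounds j.
have -> : sigma (C j) `^ a = sigma (C j) `^ (a - 2) * sigma (C j) ^+ 2.
  by rewrite -powR_mulrn ?(ltW s0) // -powRD ?(gt_eqF s0) ?implybT // subrK.
rewrite ler_wpM2r ?sqr_ge0 // ge0_ler_powR ?nnegrE ?subr_ge0 ?(ltW a2) ?(ltW s0) //.
by apply: le_trans sx; apply: ltW.
Qed.

Lemma card_mul_sqr_sigma_min :
  #|` X|%:R * sigma_min C ^+ 2 <= clustering_cost C.
Proof.
rewrite (card_clustering CX) clustering_costE mulr_suml; apply: ler_sum => j _.
have [s0 /andP[sn _]] := sigma_bounds j.
by rewrite ler_wpM2l // ler_pXn2r ?nnegrE // ltW.
Qed.

(** Combines |X| <= OPT / sigma_min^2, raised to 1 - p, with sum_j A_j <= g * sigma_max^(a - 2) *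
    OPT, raised to p. Both sigma's get the exponent 2 * (1 - p) = (a - 2) * p = 2 - 4 / a, and the
    powers of OPT multiply to OPT. *)
Lemma scale_free_cost_bound : (0 < k)%N ->
  #|` X|%:R `^ (1 - p) * (\sum_j mean_pairwise_cost a C j) `^ p
  <= concentration a C `^ p * (sigma_max C / sigma_min C) `^ (2 - 4 / a)
     * clustering_cost C.
Proof.
move=> k0; pose j0 := Ordinal k0.
have [s0 /andP[sn sx]] := sigma_bounds j0.
have x0 : 0 < sigma_max C by apply: lt_le_trans sx.
have OPT0 : 0 < clustering_cost C.
  rewrite clustering_costE (bigD1 j0) //= ltr_pwDl ?mulr_gt0 ?exprn_gt0 //.
  by apply: sumr_ge0 => j _; rewrite mulr_ge0 ?sqr_ge0.
have g0 := concentration_ge0 j0.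
have sn2 : 0 < sigma_min C ^+ 2 by rewrite exprn_gt0.
have e1 : (sigma_min C ^+ 2) `^ (1 - p) = sigma_min C `^ (2 - 4 / a).
  rewrite -powR_mulrn ?(ltW sigma0) // -powRrM; congr (_ `^ _).
  by field; rewrite gt_eqF.
have e2 : (sigma_max C `^ (a - 2)) `^ p = sigma_max C `^ (2 - 4 / a).
  by rewrite -powRrM; congr (_ `^ _); field; rewrite gt_eqF.
have nle : #|` X|%:R `^ (1 - p)
    <= (clustering_cost C / sigma_min C ^+ 2) `^ (1 - p).
  rewrite ge0_ler_powR ?nnegrE ?(ltW q0) ?divr_ge0 ?(ltW OPT0) ?(ltW sn2) //.
  by rewrite ler_pdivlMr // card_mul_sqr_sigma_min.
have Ale : (\sum_j mean_pairwise_cost a C j) `^ p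
    <= (concentration a C * (sigma_max C `^ (a - 2) * clustering_cost C)) `^ p.
  rewrite ge0_ler_powR ?nnegrE ?(ltW p0) ?sum_mean_pairwise_cost_le //.
    by apply: sumr_ge0 => j _; apply: mean_pairwise_cost_ge0.
  by rewrite !mulr_ge0 ?powR_ge0 ?(ltW OPT0).
apply: le_trans (ler_pM (powR_ge0 _ _) (powR_ge0 _ _) nle Ale) _.
rewrite !powRM ?mulr_ge0 ?invr_ge0 ?powR_ge0 ?(ltW OPT0) ?(ltW sn2) ?(ltW x0) ?(ltW sigma0) //.
have inv s t : 0 < s -> s^-1 `^ t = (s `^ t)^-1 :> R.
  by move=> sp; rewrite -(powR_inv1 (ltW sp)) -powRrM mulN1r powRN.
rewrite !inv // e1 e2.
have cE : clustering_cost C `^ (1 - p) * clustering_cost C `^ p = clustering_cost C.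
  by rewrite -powRD ?(gt_eqF OPT0) ?implybT // subrK powRr1 // ltW.
rewrite -[X in _ <= _ * X]cE le_eqVlt; apply/orP; left; apply/eqP.
move: (clustering_cost C `^ (1 - p)) (clustering_cost C `^ p)
  ((sigma_min C `^ (2 - 4 / a))^-1) => u v w; ring.
Qed.

End CostBound.

Theorem theorem1 (R : realType) :
  (exists K : R, 0 < K /\
     forall (d : nat) (X : {fset 'rV[R]_d}) (k : nat) (a : R)
            (C : 'I_k -> {fset 'rV[R]_d}),
       (1 <= k)%N ->
       2 < a ->
       is_clustering X C ->
       0 < sigma_min C ->
       seeding_expectation k a X (fun Z => cost 2 X Z)
       <= K * (alpha_factor a
               * concentration a C `^ (2 / a)
               * (sigma_max C / sigma_min C) `^ (2 - 4 / a)
               * Num.min (num_scales C)%:R (log_clusters R k) `^ (2 / a))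
          * clustering_cost C)
  /\ (exists2 M : R, 0 < M
      & \forall a \near +oo, `|alpha_factor a| <= M * `|a ^+ 2|).
Proof.
split; last first.
  exists 1 => //; near=> a; rewrite mul1r; apply: alpha_factor_le_sqr.
  by near: a; apply: nbhs_pinfty_ge; rewrite num_real.
(* The constant is set by the logarithmic case, where the bounds 16 and 24 add up to 40 and
   [alpha_factor a] is at least 4; the case of l scales gives 2 + 4 = 6. *)
exists 10; split => // d X k a C k0 a2 CX sigma0.
have p0 : 0 < 2 / a by rewrite divr_gt0 //; lra.
have p1 : 2 / a < 1 by rewrite ltr_pdivrMr ?mul1r //; lra.
have q0 : 0 < 1 - 2 / a by rewrite subr_gt0.
set Q := #|` X|%:R `^ (1 - 2 / a) * (\sum_j mean_pairwise_cost a C j) `^ (2 / a).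
have Q0 : 0 <= Q by rewrite mulr_ge0 ?powR_ge0.
have QB := scale_free_cost_bound CX a2 sigma0 k0; rewrite -/Q in QB.
have F4 := alpha_factor_ge a2.
have Fq : 4 <= alpha_factor a.
  by apply: le_trans F4; rewrite ler_pdivlMr // ler_piMr //; lra.
pose U Z : R := \sum_(j | ~~ hit C Z j)
  #|` C j|%:R `^ (1 - 2 / a) * cost a (C j) Z `^ (2 / a).
have costE : seeding_expectation k a X (fun Z => cost 2 X Z)
    <= 8 * Q + seeding_expectation k a X U.
  apply: (@le_trans _ _ (#|` X|%:R `^ (1 - 2 / a)
      * seeding_expectation k a X (fun Z => first_hit_cost a C Z `^ (2 / a))
      + seeding_expectation k a X U)).
    rewrite -seeding_expectationZ -seeding_expectationD.
    apply: le_seeding_expectation => Z Zk _; apply: cost2_le => //.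
    by rewrite -size_eq0 Zk -lt0n.
  rewrite lerD2r /Q mulrCA ler_wpM2l ?powR_ge0 //.
  exact: expected_first_hit_cost_powR.
suff main : seeding_expectation k a X (fun Z => cost 2 X Z)
    <= 10 * alpha_factor a
       * Num.min (num_scales C)%:R (log_clusters R k) `^ (2 / a) * Q.
  apply: le_trans main _.
  have w0 : 0 <= 10 * alpha_factor a
      * Num.min (num_scales C)%:R (log_clusters R k) `^ (2 / a).
    have f0 : 0 <= alpha_factor a by lra.
    by rewrite mulr_ge0 ?powR_ge0 // mulr_ge0.
  apply: le_trans (ler_wpM2l w0 QB) _.
  rewrite le_eqVlt; apply/orP; left; apply/eqP; ring.
apply: le_trans costE _; have [_|_] := leP (num_scales C)%:R (log_clusters R k).
  have l1 : 1 <= (num_scales C)%:R `^ (2 / a) :> R.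
    rewrite -[leLHS](powRr0 (num_scales C)%:R) ler_powR ?(ltW p0) //.
    by rewrite ler1n (num_scales_gt0 CX).
  have := expected_unhit_scales CX k0 a2; rewrite -/Q => US.
  apply: le_trans (lerD (lexx _) US) _.
  move: ((num_scales C)%:R `^ (2 / a)) l1 => l l1.
  have -> : 16 / (1 - 2 / a) = 4 * (4 / (1 - 2 / a)) by rewrite mulrA -natrM.
  move: (4 / (1 - 2 / a)) (alpha_factor a) F4 Fq => r f F4 Fq.
  have h1 : 8 * Q <= 2 * f * l * Q.
    by rewrite ler_wpM2r //; nra.
  have h2 : 4 * r * l * Q <= 4 * f * l * Q.
    by rewrite ler_wpM2r // ler_wpM2r //; lra.
  have h3 : 0 <= f * l * Q by rewrite mulr_ge0 // mulr_ge0 //; lra.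
  lra.
have [HL L2] := power_sum1_log R k0.
set L := log_clusters R k in HL L2 *.
have L0 : 0 <= L by lra.
have := expected_unhit_log CX k0 a2; rewrite -/Q => UL.
apply: le_trans (lerD (lexx _) UL) _.
(* Numerical constants leave the power at no more than their own value, since the exponent is below
   1. *)
have lin c : 1 <= c -> (c * L) `^ (2 / a) <= c * L `^ (2 / a).
  move=> c1; rewrite powRM //; last by lra.
  by rewrite ler_wpM2r ?powR_ge0 // ler1_powR // ltW.
have h1 : 1 <= 2 * L `^ (2 / a).
  apply: le_trans (lin 2 _); last by lra.
  apply: (@le_trans _ _ (1 `^ (2 / a))); first by rewrite powR1.
  by rewrite ge0_ler_powR ?nnegrE ?(ltW p0) //; lra.
have h2 : power_sum 1 k `^ (2 / a) <= 3 * L `^ (2 / a).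
  apply: le_trans (lin 3 _); last by lra.
  by rewrite ge0_ler_powR ?nnegrE ?power_sum_ge0 ?(ltW p0) //; lra.
move: (L `^ (2 / a)) (power_sum 1 k `^ (2 / a)) (alpha_factor a) Fq h1 h2 (powR_ge0 L (2 / a))
  => l h f Fq h1 h2 l0.
have h3 : 8 * Q <= 16 * l * Q by rewrite ler_wpM2r //; lra.
have h4 : 8 * h * Q <= 24 * l * Q by rewrite ler_wpM2r //; lra.
have h5 : 40 * l * Q <= 10 * f * l * Q.
  by rewrite ler_wpM2r // ler_wpM2r //; lra.
lra.
Unshelve. all: by end_near.
Qed.
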